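(* Let $(G,H,t,\alpha)$ be a crossed module with $G$ and $H$ finite and write $\mathcal{G}$ for its associated strict $2$-group. The monoidal category $\mathrm{Rep}_{\mathcal{G}}(L)$ is rigid if and only if $\operatorname{char}\Bbbk$ does not divide the order of $L=\ker t$.
   Context: Fix a field $\Bbbk$. A crossed module $(G,H,t,\alpha)$ consists of groups $G,H$ and homomorphisms $t\colon H\to G$, $\alpha\colon G\to\mathrm{Aut}(H)$ with $t(\alpha(g)h)=g\,t(h)g^{-1}$ and $\alpha(t(l))h=lhl^{-1}$ for all $g\in G$, $h,l\in H$. Its associated strict $2$-group $\mathcal{G}$ is the strict monoidal groupoid with object set $G$, $\mathcal{G}(g,g')=\{(h,g)\in H\times G\mid t(h)g=g'\}$, composition $(h',t(h)g)\circ(h,g)=(h'h,g)$ and tensor product $(h,g)\otimes(h',g')=(h\,\alpha(g)h',gg')$. Put $K=\operatorname{im}t$ (normal in $G$), $L=\ker t$ (central in $H$), $Q=G/K$, and let $\overline{\alpha}\colon Q\to\mathrm{Aut}(L)$ be the homomorphism with $\overline{\alpha}([g])l=\alpha(g)l$. $\mathrm{Rep}(L)$ is the category of finite-dimensional $\Bbbk$-representations of $L$, and $\mathrm{Rep}_{\mathcal{G}}(L)=\bigoplus_{q\in Q}\mathrm{Rep}(L)_q$ with $\mathrm{Rep}(L)_q=\mathrm{Rep}(L)$. Its monoidal structure is given, for $M$ of degree $p$ and $N$ of degree $q$, by $M\otimes N=M\otimes_{\Bbbk L}N^{\overline{\alpha}(p^{-1})}$ placed in degree $pq$, with unit $\Bbbk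 L$ in degree $[1]$. Here $N^{\overline{\alpha}(p^{-1})}$ is the vector space $N$ with $l$ acting as $\overline{\alpha}(p^{-1})l$, and $L$ acts on the tensor product by $l\cdot(m\otimes n)=(lm)\otimes n$. (It corresponds to Day convolution under an equivalence of $\mathrm{Rep}_{\mathcal{G}}(L)$ with the category of functors from $\mathcal{G}$ to finite-dimensional vector spaces.) A monoidal category is rigid if every object $x$ has a right dual ($x^\vee$ with $x\otimes x^\vee\to1$, $1\to x^\vee\otimes x$ satisfying the snake identities) and a left dual (the same for the reversed tensor product). *)

(* Defs.v *)
From Stdlib Require Import FunctionalExtensionality.
From HB Require Import structures.
From mathcomp Require Import all_boot all_order all_fingroup all_algebra.

Set Implicit Arguments.
Unset Strict Implicit.
Unset Printing Implicit Defensive.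

Import GRing.Theory.
Local Open Scope ring_scope.

Declare Scope cat_scope.
Delimit Scope cat_scope with cat.

Record category := Category {
  ob :> Type;
  hom : ob -> ob -> Type;
  idm : forall x, hom x x;
  ccomp : forall x y z, hom y z -> hom x y -> hom x z;
  comp_idl : forall x y (f : hom x y), ccomp (idm y) f = f;
  comp_idr : forall x y (f : hom x y), ccomp f (idm x) = f;
  compA : forall x y z w (f : hom x y) (g : hom y z) (h : hom z w),
    ccomp h (ccomp g f) = ccomp (ccomp h g) f }.

Arguments hom {c} x y.
Arguments idm {c} x.
Arguments ccomp {c x y z} g f.
Notation "g ∘ f" := (ccomp g f) (at level 40, left associativity) : cat_scope.

Local Open Scope cat_scope.

Record monoidal_category := MonoidalCategory {
  mcat :> category;
  mtens : mcat -> mcat -> mcat;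
  mtensM : forall x x' y y' : mcat,
    hom x x' -> hom y y' -> hom (mtens x y) (mtens x' y');
  munit : mcat;
  massoc : forall x y z, hom (mtens (mtens x y) z) (mtens x (mtens y z));
  massocV : forall x y z, hom (mtens x (mtens y z)) (mtens (mtens x y) z);
  mlunit : forall x, hom (mtens munit x) x;
  mlunitV : forall x, hom x (mtens munit x);
  mrunit : forall x, hom (mtens x munit) x;
  mrunitV : forall x, hom x (mtens x munit);
  mtensM_id : forall x y, mtensM (idm x) (idm y) = idm (mtens x y);
  mtensM_comp : forall (x x' x'' y y' y'' : mcat) (f : hom x x')
      (f' : hom x' x'') (g : hom y y') (g' : hom y' y''),
    mtensM (f' ∘ f) (g' ∘ g) = mtensM f' g' ∘ mtensM f g;
  massocK : forall x y z, massocV x y z ∘ massoc x y z = idm _;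
  massocVK : forall x y z, massoc x y z ∘ massocV x y z = idm _;
  mlunitK : forall x, mlunitV x ∘ mlunit x = idm _;
  mlunitVK : forall x, mlunit x ∘ mlunitV x = idm _;
  mrunitK : forall x, mrunitV x ∘ mrunit x = idm _;
  mrunitVK : forall x, mrunit x ∘ mrunitV x = idm _;
  massoc_nat : forall (x x' y y' z z' : mcat)
      (f : hom x x') (g : hom y y') (h : hom z z'),
    massoc x' y' z' ∘ mtensM (mtensM f g) h
      = mtensM f (mtensM g h) ∘ massoc x y z;
  mlunit_nat : forall (x y : mcat) (f : hom x y),
    mlunit y ∘ mtensM (idm munit) f = f ∘ mlunit x;
  mrunit_nat : forall (x y : mcat) (f : hom x y),
    mrunit y ∘ mtensM f (idm munit) = f ∘ mrunit x;
  mpentagon : forall x y z w,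
    massoc x y (mtens z w) ∘ massoc (mtens x y) z w
      = mtensM (idm x) (massoc y z w) ∘ massoc x (mtens y z) w
        ∘ mtensM (massoc x y z) (idm w);
  mtriangle : forall x y,
    mtensM (idm x) (mlunit y) ∘ massoc x munit y = mtensM (mrunit x) (idm y) }.

Arguments mtens {m} x y.
Arguments mtensM {m x x' y y'} f g.
Arguments munit {m}.
Arguments massoc {m} x y z.
Arguments massocV {m} x y z.
Arguments mlunit {m} x.
Arguments mlunitV {m} x.
Arguments mrunit {m} x.
Arguments mrunitV {m} x.

Notation "x ⊗ y" := (mtens x y) (at level 35, right associativity) : cat_scope.
Notation "f ⊗m g" := (mtensM f g) (at level 35, right associativity) : cat_scope.

Section Rigid.
Variable C : monoidal_category.
Implicit Types x y : C.

Definition snake1 x y (ev : hom (x ⊗ y) munit) (coev : hom munit (y ⊗ x)) :=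
  mlunit x ∘ (ev ⊗m idm x) ∘ massocV x y x ∘ (idm x ⊗m coev) ∘ mrunitV x
  = idm x.

Definition snake2 x y (ev : hom (x ⊗ y) munit) (coev : hom munit (y ⊗ x)) :=
  mrunit y ∘ (idm y ⊗m ev) ∘ massoc y x y ∘ (coev ⊗m idm y) ∘ mlunitV y
  = idm y.

Definition right_dual x y :=
  exists (ev : hom (x ⊗ y) munit) (coev : hom munit (y ⊗ x)),
    snake1 ev coev /\ snake2 ev coev.

(* For the reversed tensor product the evaluation is y ⊗ x -> 1, the          *)
(* coevaluation is 1 -> x ⊗ y, and the two snake identities are exchanged.    *)
Definition left_dual x y :=
  exists (ev : hom (y ⊗ x) munit) (coev : hom munit (x ⊗ y)),
    snake2 ev coev /\ snake1 ev coev.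

Definition rigid :=
  forall x, (exists y, right_dual x y) /\ (exists y, left_dual x y).

End Rigid.

(* V / U, realized on the chosen complement of U; quot_pi is surjective with  *)
(* kernel U.                                                                  *)
Section Quotient.
Variables (k : fieldType) (V : vectType k) (U : {vspace V}).

Definition quotv : vectType k := subvs_of (U^C)%VS.

Definition quot_pi (v : V) : quotv := vsproj (U^C)%VS (v - projv U v).

Lemma quot_pi_is_linear : linear quot_pi.
Proof.
move=> a u v; rewrite /quot_pi -linearP; congr (vsproj _ _).
by rewrite linearP /= scalerBr opprD addrACA.
Qed.
HB.instance Definition _ :=
  GRing.isLinear.Build k V quotv _ quot_pi quot_pi_is_linear.

Lemma vsval_quot_pi v : vsval (quot_pi v) = v - projv U v.
Proof. by rewrite vsprojK // memv_projC. Qed.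

Lemma quot_pi_ker v : (quot_pi v == 0) = (v \in U).
Proof.
apply/eqP/idP => [/(congr1 vsval)|vU].
  rewrite vsval_quot_pi linear0 => /eqP; rewrite subr_eq0 => /eqP ->.
  exact: memv_proj.
by apply/subvs_inj; rewrite vsval_quot_pi projv_id // subrr linear0.
Qed.

Lemma quot_piK w : quot_pi (vsval w) = w.
Proof.
apply/subvs_inj; rewrite vsval_quot_pi; apply/eqP.
rewrite subr_eq addrC -subr_eq subrr eq_sym.
have: vsval w - projv U (vsval w) \in (U^C)%VS by exact: memv_projC.
move/(memvB (subvsP w)); rewrite opprB addrCA subrr addr0 => h.
by rewrite -memv0 -(capv_compl U) memv_cap memv_proj h.
Qed.

End Quotient.

Section DirectSum.
Variables (k : fieldType) (I : finType) (V : I -> vectType k).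

Definition dsum := {dffun forall i, V i}.
HB.instance Definition _ := Choice.on dsum.

Implicit Types f g h : dsum.

Definition dsum_zero : dsum := [ffun i => 0].
Definition dsum_opp f : dsum := [ffun i => - f i].
Definition dsum_add f g : dsum := [ffun i => f i + g i].
Definition dsum_scale (a : k) f : dsum := [ffun i => a *: f i].

Fact dsum_addA : associative dsum_add.
Proof. by move=> f g h; apply/ffunP=> i; rewrite !ffunE addrA. Qed.
Fact dsum_addC : commutative dsum_add.
Proof. by move=> f g; apply/ffunP=> i; rewrite !ffunE addrC. Qed.
Fact dsum_add0 : left_id dsum_zero dsum_add.
Proof. by move=> f; apply/ffunP=> i; rewrite !ffunE add0r. Qed.
Fact dsum_addN : left_inverse dsum_zero dsum_opp dsum_add.
Proof. by move=> f; apply/ffunP=> i; rewrite !ffunE addNr. Qed.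
HB.instance Definition _ :=
  GRing.isZmodule.Build dsum dsum_addA dsum_addC dsum_add0 dsum_addN.

Fact dsum_scaleA a b f : dsum_scale a (dsum_scale b f) = dsum_scale (a * b) f.
Proof. by apply/ffunP=> i; rewrite !ffunE scalerA. Qed.
Fact dsum_scale1 : left_id 1 dsum_scale.
Proof. by move=> f; apply/ffunP=> i; rewrite !ffunE scale1r. Qed.
Fact dsum_scaleDr : right_distributive dsum_scale +%R.
Proof. by move=> a f g; apply/ffunP=> i; rewrite !ffunE scalerDr. Qed.
Fact dsum_scaleDl f : {morph dsum_scale^~ f : a b / a + b}.
Proof. by move=> a b; apply/ffunP=> i; rewrite !ffunE scalerDl. Qed.
HB.instance Definition _ := GRing.Zmodule_isLmodule.Build k dsum
  dsum_scaleA dsum_scale1 dsum_scaleDr dsum_scaleDl.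

Import VectorInternalTheory.
Fact dsum_vect_iso :
  Vector.axiom (\sum_(j < #|I|) dim (V (enum_val j))) dsum.
Proof.
pose of_mx (r : 'rV[k]_(\sum_(j < #|I|) dim (V (enum_val j)))) : dsum :=
  [ffun i => eq_rect _ (fun i => Vector.sort (V i))
     (r2v (submxrow r (enum_rank i))) i (enum_rankK i)].
have of_mxE r j : of_mx r (enum_val j) = r2v (submxrow r j).
  rewrite ffunE; move: (enum_rankK _); rewrite enum_valK => e.
  by rewrite (eq_axiomK e).
exists (fun f => \mxrow_j v2r (f (enum_val j))).
  by move=> a f g; apply/rowP=> c; rewrite !mxE !ffunE linearP !mxE.
exists of_mx => [f | r].
  by apply/ffunP=> i; rewrite -(enum_rankK i) of_mxE mxrowK v2rK.
by apply/mxrowP=> j; rewrite mxrowK of_mxE r2vK.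
Qed.
HB.instance Definition _ := Lmodule_hasFinDim.Build k dsum dsum_vect_iso.

Lemma dsum0E i : (0 : dsum) i = 0. Proof. by rewrite ffunE. Qed.
Lemma dsumDE f g i : (f + g) i = f i + g i. Proof. by rewrite ffunE. Qed.
Lemma dsumZE a f i : (a *: f) i = a *: f i. Proof. by rewrite ffunE. Qed.

Definition dsum_in i (v : V i) : dsum :=
  [ffun j => dfwith (fun j => 0 : V j) v j].

Lemma dsum_in_id i (v : V i) : dsum_in v i = v.
Proof. by rewrite ffunE dfwith_in. Qed.
Lemma dsum_in_neq i j (v : V i) : i != j -> dsum_in v j = 0.
Proof. by move=> ij; rewrite ffunE dfwith_out. Qed.

Lemma dsum_in_is_linear i : linear (@dsum_in i).
Proof.
move=> a u v; apply/ffunP=> j; rewrite dsumDE dsumZE.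
have [<-|ij] := eqVneq i j; first by rewrite !dsum_in_id.
by rewrite !dsum_in_neq // scaler0 addr0.
Qed.
HB.instance Definition _ i :=
  GRing.isLinear.Build k (V i) dsum _ (@dsum_in i) (@dsum_in_is_linear i).

Lemma dsum_sumE f : f = \sum_i dsum_in (f i).
Proof.
apply/ffunP=> j; have -> : (\sum_i dsum_in (f i)) j = \sum_i dsum_in (f i) j.
  by elim/big_rec2: _ => [|i x y _ <-]; rewrite ?dsum0E ?dsumDE.
rewrite (bigD1 j) //= dsum_in_id big1 ?addr0 // => i ij.
by rewrite dsum_in_neq.
Qed.

End DirectSum.

Section Representations.
Variables (k : fieldType) (A : finGroupType).

Record rep := Rep {
  rep_space :> vectType k;
  rep_act : A -> 'End(rep_space);
  rep_act1 : rep_act 1%g = \1%VF;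
  rep_actM : forall a b, rep_act (a * b)%g = (rep_act a \o rep_act b)%VF }.

Definition equivariant (M N : rep) (f : 'Hom(M, N)) :=
  [forall a, (f \o rep_act M a == rep_act N a \o f)%VF].

Record rep_hom (M N : rep) := RepHom {
  rep_fun :> 'Hom(M, N);
  rep_funP : equivariant rep_fun }.

Lemma equivariantP (M N : rep) (f : 'Hom(M, N)) :
  reflect (forall a m, f (rep_act M a m) = rep_act N a (f m)) (equivariant f).
Proof.
apply: (iffP forallP) => [h a m | h a].
  by have /eqP/lfunP/(_ m) := h a; rewrite !comp_lfunE.
by apply/eqP/lfunP=> m; rewrite !comp_lfunE.
Qed.

Lemma rep_homE (M N : rep) (f : rep_hom M N) a m :
  f (rep_act M a m) = rep_act N a (f m).
Proof. exact: (equivariantP _ (rep_funP f)). Qed.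

Lemma rep_hom_eq (M N : rep) (f g : rep_hom M N) : f =1 g -> f = g.
Proof.
case: f g => [f hf] [g hg] /= /lfunP fg; case: g / fg hg => hg.
by rewrite (bool_irrelevance hf hg).
Qed.

Lemma rep_act1E (M : rep) m : rep_act M 1%g m = m.
Proof. by rewrite rep_act1 id_lfunE. Qed.
Lemma rep_actME (M : rep) a b m :
  rep_act M (a * b)%g m = rep_act M a (rep_act M b m).
Proof. by rewrite rep_actM comp_lfunE. Qed.

Lemma id_equivariant M : equivariant (\1%VF : 'End(rep_space M)).
Proof. by apply/equivariantP=> a m; rewrite !id_lfunE. Qed.
Definition rep_id M : rep_hom M M := RepHom (id_equivariant M).

Lemma comp_equivariant M N P (g : rep_hom N P) (f : rep_hom M N) :
  equivariant (g \o f)%VF.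
Proof. by apply/equivariantP=> a m; rewrite !comp_lfunE !rep_homE. Qed.
Definition rep_comp M N P (g : rep_hom N P) (f : rep_hom M N) : rep_hom M P :=
  RepHom (comp_equivariant g f).

Lemma rep_idE M m : rep_id M m = m. Proof. exact: id_lfunE. Qed.
Lemma rep_compE M N P (g : rep_hom N P) (f : rep_hom M N) m :
  rep_comp g f m = g (f m).
Proof. exact: comp_lfunE. Qed.

Definition rep_zero : rep :=
  @Rep 'rV[k]_0 (fun _ => \1%VF) erefl (fun _ _ => esym (comp_lfun1l _)).

(* The regular representation kA: the function x stands for \sum_a x(a) a.    *)
Definition reg_act (a : A) (x : {ffun A -> k^o}) : {ffun A -> k^o} :=
  [ffun b => x (a^-1 * b)%g].
Lemma reg_act_is_linear a : linear (reg_act a).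
Proof. by move=> c x y; apply/ffunP=> b; rewrite !ffunE. Qed.
HB.instance Definition _ a :=
  GRing.isLinear.Build k _ _ _ (reg_act a) (reg_act_is_linear a).

Lemma reg_act1 : linfun (reg_act 1%g) = \1%VF.
Proof.
apply/lfunP=> x; rewrite lfunE id_lfunE /=; apply/ffunP=> b.
by rewrite ffunE invg1 mul1g.
Qed.
Lemma reg_actM a b :
  linfun (reg_act (a * b)%g) = (linfun (reg_act a) \o linfun (reg_act b))%VF.
Proof.
apply/lfunP=> x; rewrite comp_lfunE !lfunE /=; apply/ffunP=> c.
by rewrite !ffunE invMg mulgA.
Qed.
Definition rep_reg : rep := Rep reg_act1 reg_actM.

Lemma rep_regE a (x : rep_reg) b :
  (rep_act rep_reg a x : {ffun A -> k^o}) b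
    = (x : {ffun A -> k^o}) (a^-1 * b)%g.
Proof. by rewrite lfunE ffunE. Qed.

Section RepDirectSum.
Variables (I : finType) (M : I -> rep).

Definition rdsum_space : vectType k := dsum (fun i => rep_space (M i)).

Definition rdsum_act (a : A) (x : rdsum_space) : rdsum_space :=
  [ffun i => rep_act (M i) a (x i)].
Lemma rdsum_act_is_linear a : linear (rdsum_act a).
Proof. by move=> c x y; apply/ffunP=> i; rewrite !ffunE linearP. Qed.
HB.instance Definition _ a :=
  GRing.isLinear.Build k _ _ _ (rdsum_act a) (rdsum_act_is_linear a).

Lemma rdsum_act1 : linfun (rdsum_act 1%g) = \1%VF.
Proof.
apply/lfunP=> x; rewrite lfunE id_lfunE /=; apply/ffunP=> i.
by rewrite ffunE rep_act1E.
Qed.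
Lemma rdsum_actM a b : linfun (rdsum_act (a * b)%g)
  = (linfun (rdsum_act a) \o linfun (rdsum_act b))%VF.
Proof.
apply/lfunP=> x; rewrite comp_lfunE !lfunE /=; apply/ffunP=> i.
by rewrite !ffunE rep_actME.
Qed.
Definition rep_dsum : rep := Rep rdsum_act1 rdsum_actM.

Lemma rep_dsumE a (x : rep_dsum) i :
  (rep_act rep_dsum a x : dsum _) i = rep_act (M i) a ((x : dsum _) i).
Proof. by rewrite lfunE ffunE. Qed.

End RepDirectSum.

End Representations.

Arguments rep_id {k A} M.

Section Tensor.
Variables (k : fieldType) (A : finGroupType) (cA : forall a b : A, (a * b = b * a)%g).
Variables M N : rep k A.

Let e := vbasis {:rep_space M}.
Let f := vbasis {:rep_space N}.

(* The tensor product over k as a space of matrices.                          *)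
Definition ktens (m : M) (n : N) :
    'M[k]_(\dim {:rep_space M}, \dim {:rep_space N}) :=
  \matrix_(i, j) (coord e i m * coord f j n).

Definition tensor_rel :
    {vspace 'M[k]_(\dim {:rep_space M}, \dim {:rep_space N})} :=
  (\sum_(a : A) <<[seq ktens (rep_act M a m) n - ktens m (rep_act N a n)
                  | m <- e, n <- f]>>)%VS.

Definition tensor_space : vectType k := quotv tensor_rel.

Definition tensor_val (t : tensor_space) :
  'M[k]_(\dim {:rep_space M}, \dim {:rep_space N}) := vsval t.
Lemma tensor_val_is_linear c (x y : tensor_space) :
  tensor_val (c *: x + y) = c *: tensor_val x + tensor_val y.
Proof. by []. Qed.

Definition tens (m : M) (n : N) : tensor_space :=
  quot_pi tensor_rel (ktens m n).

Record balanced (W : vectType k) (b : M -> N -> W) : Prop := Balanced {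
  balanced_l : forall n, linear (b^~ n);
  balanced_r : forall m, linear (b m);
  balanced_act : forall a m n, b (rep_act M a m) n = b m (rep_act N a n) }.

(* The linear map with tens m n |-> b m n, provided b is balanced.            *)
Definition tlift_fun (W : vectType k) (b : M -> N -> W) (t : tensor_space) : W :=
  \sum_i \sum_j tensor_val t i j *: b e`_i f`_j.
Lemma tlift_fun_is_linear (W : vectType k) (b : M -> N -> W) :
  linear (@tlift_fun W b).
Proof.
move=> c x y; rewrite /tlift_fun scaler_sumr -big_split; apply: eq_bigr => i _.
rewrite scaler_sumr -big_split; apply: eq_bigr => j _ /=.
by rewrite !mxE scalerDl scalerA.
Qed.
HB.instance Definition _ (W : vectType k) (b : M -> N -> W) :=
  GRing.isLinear.Build k tensor_space W _ (@tlift_fun W b)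
    (@tlift_fun_is_linear W b).
Definition tlift (W : vectType k) (b : M -> N -> W) : 'Hom(tensor_space, W) :=
  linfun (tlift_fun b).

Lemma ktens_linl n : linear (ktens^~ n).
Proof.
by move=> c x y; apply/matrixP=> i j; rewrite !mxE linearP mulrDl mulrA.
Qed.
Lemma ktens_linr m : linear (ktens m).
Proof.
by move=> c x y; apply/matrixP=> i j; rewrite !mxE linearP mulrDr mulrCA.
Qed.

Lemma basisE (V : vectType k) (v : V) :
  v = \sum_i coord (vbasis {:V}) i v *: (vbasis {:V})`_i.
Proof. exact: coord_vbasis (memvf v). Qed.

Lemma coord_vbasis_id (V : vectType k) (i j : 'I_(\dim {:V})) :
  coord (vbasis {:V}) i (vbasis {:V})`_j = (i == j)%:R.
Proof. by rewrite coord_free ?(basis_free (vbasisP _)) // eq_sym. Qed.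

Lemma lin_sum (V W : vectType k) (g : V -> W) (h : linear g)
    (J : finType) (c : J -> k) (x : J -> V) :
  g (\sum_i c i *: x i) = \sum_i c i *: g (x i).
Proof.
pose g' := HB.pack_for {linear V -> W} g (GRing.isLinear.Build _ _ _ _ g h).
rewrite -[g]/(g' : V -> W) linear_sum; apply: eq_bigr => i _.
by rewrite linearZ.
Qed.

Lemma bilin_expand (W : vectType k) (b : M -> N -> W) :
    (forall n, linear (b^~ n)) -> (forall m, linear (b m)) -> forall m n,
  b m n = \sum_i \sum_j (coord e i m * coord f j n) *: b e`_i f`_j.
Proof.
move=> bl br m n; rewrite {1}[m]basisE (lin_sum (bl n)).
apply: eq_bigr => i _; rewrite {1}[n]basisE (lin_sum (br _)) scaler_sumr.
by apply: eq_bigr => j _; rewrite scalerA.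
Qed.

Lemma tensor_relP a m n :
  ktens (rep_act M a m) n - ktens m (rep_act N a n) \in tensor_rel.
Proof.
pose b m n := ktens (rep_act M a m) n - ktens m (rep_act N a n).
have bl n' : linear (b^~ n').
  move=> c x y; rewrite /b linearP !ktens_linl scalerBr opprD.
  by rewrite addrACA.
have br m' : linear (b m').
  move=> c x y; rewrite /b linearP !ktens_linr scalerBr opprD.
  by rewrite addrACA.
rewrite -/(b m n) (bilin_expand bl br).
apply: rpred_sum => i _; apply: rpred_sum => j _; apply: rpredZ.
apply: (subvP (sumv_sup a (erefl true) (subvv _))).
by apply: memv_span; apply: allpairs_f; rewrite mem_nth ?size_tuple.
Qed.

Lemma tens_act a m n : tens (rep_act M a m) n = tens m (rep_act N a n).
Proof.
apply/eqP; rewrite -subr_eq0 -linearB /= quot_pi_ker; exact: tensor_relP.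
Qed.

Lemma tens_balanced : balanced tens.
Proof.
split=> [n c x y|m c x y|]; rewrite ?/tens ?ktens_linl ?ktens_linr ?linearP //.
exact: tens_act.
Qed.

Lemma tensDl m m' n : tens (m + m') n = tens m n + tens m' n.
Proof.
rewrite /tens -linearD; congr quot_pi.
by apply/matrixP=> i j; rewrite !mxE linearD mulrDl.
Qed.
Lemma tensDr m n n' : tens m (n + n') = tens m n + tens m n'.
Proof.
rewrite /tens -linearD; congr quot_pi.
by apply/matrixP=> i j; rewrite !mxE linearD mulrDr.
Qed.
Lemma tensZl c m n : tens (c *: m) n = c *: tens m n.
Proof.
rewrite /tens -linearZ; congr quot_pi.
by apply/matrixP=> i j; rewrite !mxE linearZ mulrA.
Qed.
Lemma tensZr c m n : tens m (c *: n) = c *: tens m n.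
Proof.
rewrite /tens -linearZ; congr quot_pi.
by apply/matrixP=> i j; rewrite !mxE linearZ mulrCA.
Qed.

Lemma tliftE (W : vectType k) (b : M -> N -> W) : balanced b ->
  forall m n, tlift b (tens m n) = b m n.
Proof.
case=> bl br ba m n; rewrite lfunE /=.
pose g (X : 'M[k]_(\dim {:rep_space M}, \dim {:rep_space N})) : W :=
  \sum_i \sum_j X i j *: b e`_i f`_j.
have gl : linear g.
  move=> c x y; rewrite /g scaler_sumr -big_split; apply: eq_bigr => i _.
  rewrite scaler_sumr -big_split; apply: eq_bigr => j _ /=.
  by rewrite !mxE scalerDl scalerA.
pose g' := HB.pack_for {linear _ -> W} g (GRing.isLinear.Build _ _ _ _ g gl).
have gk m' n' : g (ktens m' n') = b m' n'.
  rewrite (bilin_expand bl br); apply: eq_bigr => i _; apply: eq_bigr => j _.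
  by rewrite mxE.
have g0 X : X \in tensor_rel -> g X = 0.
  rewrite -[g X]/(g' X) -(lfunE g') => /memv_sumP[/= Y hY ->].
  rewrite linear_sum big1 // => a _; apply/eqP; rewrite -memv_ker.
  move: (Y a) (hY a erefl); apply/subvP; apply/span_subvP=> Z.
  move=> /allpairsP[[m' n'] /= [_ _ ->]]; rewrite memv_ker (lfunE g') (linearB g').
  by rewrite -![GRing.Linear.sort g' _]/(g _) !gk ba subrr.
rewrite /tlift_fun -[LHS]/(g' (vsval (tens m n))) vsval_quot_pi (linearB g').
by rewrite -![GRing.Linear.sort g' _]/(g _) gk (g0 _ (memv_proj _ _)) subr0.
Qed.

Lemma tens_gen (t : tensor_space) : 
  exists c : 'M[k]_(\dim {:rep_space M}, \dim {:rep_space N}),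
    t = \sum_i \sum_j c i j *: tens e`_i f`_j.
Proof.
exists (tensor_val t); rewrite -{1}[t]quot_piK.
have -> : vsval t = \sum_i \sum_j tensor_val t i j *: ktens e`_i f`_j.
  apply/matrixP=> i j; rewrite summxE (bigD1 i) //= summxE (bigD1 j) //=.
  rewrite !mxE !coord_vbasis_id !eqxx !mulr1.
  rewrite big1 ?addr0 => [|j' jj']; last first.
    by rewrite !mxE !coord_vbasis_id [j == _]eq_sym (negPf jj') !mulr0.
  rewrite big1 ?addr0 // => i' ii'; rewrite summxE big1 // => j' _.
  by rewrite !mxE !coord_vbasis_id [i == _]eq_sym (negPf ii') mul0r mulr0.
rewrite linear_sum; apply: eq_bigr => i _; rewrite linear_sum.
by apply: eq_bigr => j _; rewrite linearZ.
Qed.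

Lemma tens_ext (W : vectType k) (g h : 'Hom(tensor_space, W)) :
  (forall m n, g (tens m n) = h (tens m n)) -> g = h.
Proof.
move=> gh; apply/lfunP=> t; have [c ->] := tens_gen t.
rewrite !linear_sum; apply: eq_bigr => i _; rewrite !linear_sum.
by apply: eq_bigr => j _; rewrite !linearZ /= gh.
Qed.

Definition tensor_act a : 'End(tensor_space) :=
  tlift (fun m n => tens (rep_act M a m) n).

Lemma tensor_actE a m n : tensor_act a (tens m n) = tens (rep_act M a m) n.
Proof.
rewrite tliftE //; have [tl tr ta] := tens_balanced.
split=> [n' c x y|m'|b m' n'].
- by rewrite linearP tl.
- exact: tr.
- by rewrite -ta -!rep_actME cA.
Qed.

Lemma tensor_act1 : tensor_act 1%g = \1%VF.
Proof.
by apply: tens_ext => m n; rewrite tensor_actE rep_act1E id_lfunE.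
Qed.
Lemma tensor_actM a b : tensor_act (a * b)%g = (tensor_act a \o tensor_act b)%VF.
Proof.
by apply: tens_ext => m n; rewrite comp_lfunE !tensor_actE rep_actME.
Qed.

Definition rep_tensor : rep k A := Rep tensor_act1 tensor_actM.

End Tensor.

(* A homomorphism Q -> Aut(A), i.e., a left action of Q on A by automorphisms *)
Record aut_action (Q A : finGroupType) := AutAction {
  aut_fun :> Q -> A -> A;
  aut_mul : forall q a b, aut_fun q (a * b)%g = (aut_fun q a * aut_fun q b)%g;
  aut_act1 : forall a, aut_fun 1%g a = a;
  aut_actM : forall p q a, aut_fun (p * q)%g a = aut_fun p (aut_fun q a) }.

Lemma lfun_combE (k : fieldType) (V W : vectType k) c (f g : 'Hom(V, W)) x :
  (c *: f + g) x = c *: f x + g x.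
Proof. by rewrite add_lfunE scale_lfunE. Qed.

Lemma linfun_linE (k : fieldType) (V W : vectType k) (g : V -> W)
    (h : linear g) x :
  linfun g x = g x.
Proof.
exact: (lfunE (HB.pack_for {linear V -> W} g (GRing.isLinear.Build _ _ _ _ g h))).
Qed.

Section Twist.
Variables (k : fieldType) (A : finGroupType).
Variables (s : A -> A) (sM : {morph s : a b / (a * b)%g}) (N : rep k A).

Lemma twist_act1 : rep_act N (s 1%g) = \1%VF.
Proof.
suff -> : s 1%g = 1%g by rewrite rep_act1.
by apply: (mulgI (s 1%g)); rewrite -sM !mulg1.
Qed.
Lemma twist_actM a b :
  rep_act N (s (a * b)%g) = (rep_act N (s a) \o rep_act N (s b))%VF.
Proof. by rewrite sM rep_actM. Qed.

Definition rep_twist : rep k A :=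
  Rep (rep_act := fun a => rep_act N (s a)) twist_act1 twist_actM.
End Twist.

Section Graded.
Variables (k : fieldType) (Q A : finGroupType).
Variables (cA : forall a b : A, (a * b = b * a)%g) (phi : aut_action Q A).

(* Since Q is finite, an object of \bigoplus_q Rep(A)_q is any family.        *)
Definition grep := Q -> rep k A.

Definition ghom (M N : grep) := forall q, rep_hom (M q) (N q).
Definition gid (M : grep) : ghom M M := fun q => rep_id (M q).
Definition gcomp (M N P : grep) (g : ghom N P) (f : ghom M N) : ghom M P :=
  fun q => rep_comp (g q) (f q).

Lemma ghom_eq (M N : grep) (f g : ghom M N) : (forall q, f q =1 g q) -> f = g.
Proof.
by move=> fg; apply: functional_extensionality_dep => q; apply: rep_hom_eq.
Qed.

Lemma gcomp_idl M N (f : ghom M N) : gcomp (gid N) f = f.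
Proof. by apply: ghom_eq => q m; rewrite rep_compE rep_idE. Qed.
Lemma gcomp_idr M N (f : ghom M N) : gcomp f (gid M) = f.
Proof. by apply: ghom_eq => q m; rewrite rep_compE rep_idE. Qed.
Lemma gcompA M N P R (f : ghom M N) (g : ghom N P) (h : ghom P R) :
  gcomp h (gcomp g f) = gcomp (gcomp h g) f.
Proof. by apply: ghom_eq => q m; rewrite !rep_compE. Qed.

Definition gcat : category := Category gcomp_idl gcomp_idr gcompA.

(* The summand M_p ⊗_kA (N_q)^(phi p^-1) of the tensor product.              *)
Definition gtensor2 (M N : grep) (p q : Q) : rep k A :=
  rep_tensor cA (M p) (rep_twist (aut_mul phi p^-1%g) (N q)).

(* (M ⊗ N)_r is the direct sum of these summands over the pairs p, q with    *)
(* p q = r.                                                                   *)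
Definition gsplit (r : Q) := {pq : Q * Q | (pq.1 * pq.2)%g == r}.
Definition gtensor (M N : grep) : grep := fun r =>
  rep_dsum (fun i : gsplit r => gtensor2 M N (val i).1 (val i).2).

Section GTensor.
Variables M N : grep.

(* The class of m ⊗ n, locked to keep unification from looking inside.        *)
Fact gtens_key : unit. Proof. by []. Qed.
Definition gtens_def p q r (H : (p * q)%g == r) (m : M p) (n : N q) :
    gtensor M N r :=
  dsum_in (V := fun i : gsplit r => rep_space (gtensor2 M N (val i).1 (val i).2))
    (i := exist (fun pq : Q * Q => (pq.1 * pq.2)%g == r) (p, q) H)
    (tens (M := M p) (N := rep_twist (aut_mul phi p^-1%g) (N q)) m n).

Definition gtens := locked_with gtens_key gtens_def.
Lemma gtensE : gtens = gtens_def. Proof. by rewrite /gtens unlock. Qed.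

Lemma gtensDl p q r (H : (p * q)%g == r) m m' (n : N q) :
  gtens H (m + m') n = gtens H m n + gtens H m' n.
Proof. by rewrite gtensE /gtens_def tensDl linearD. Qed.
Lemma gtensDr p q r (H : (p * q)%g == r) (m : M p) n n' :
  gtens H m (n + n') = gtens H m n + gtens H m n'.
Proof. by rewrite gtensE /gtens_def (tensDr (N := rep_twist _ (N q))) linearD. Qed.
Lemma gtensZl p q r (H : (p * q)%g == r) c m (n : N q) :
  gtens H (c *: m) n = c *: gtens H m n.
Proof. by rewrite gtensE /gtens_def tensZl linearZ. Qed.
Lemma gtensZr p q r (H : (p * q)%g == r) c (m : M p) n :
  gtens H m (c *: n) = c *: gtens H m n.
Proof. by rewrite gtensE /gtens_def (tensZr (N := rep_twist _ (N q))) linearZ. Qed.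

Lemma gtens0l p q r (H : (p * q)%g == r) (n : N q) : gtens H (0 : M p) n = 0.
Proof. by rewrite -(scale0r (0 : M p)) gtensZl scale0r. Qed.
Lemma gtens0r p q r (H : (p * q)%g == r) (m : M p) : gtens H m (0 : N q) = 0.
Proof. by rewrite -(scale0r (0 : N q)) gtensZr scale0r. Qed.

Lemma gtens_act p q r (H : (p * q)%g == r) a (m : M p) (n : N q) :
  gtens H (rep_act (M p) a m) n
    = gtens H m (rep_act (N q) (phi p^-1%g a) n).
Proof. by rewrite gtensE /gtens_def (tens_act (N := rep_twist _ (N q))). Qed.

Lemma gact_tens p q r (H : (p * q)%g == r) a (m : M p) (n : N q) :
  rep_act (gtensor M N r) a (gtens H m n) = gtens H (rep_act (M p) a m) n.
Proof.
apply/ffunP=> i; rewrite rep_dsumE gtensE /gtens_def.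
have [<-|ij] := eqVneq (exist (fun pq : Q * Q => (pq.1 * pq.2)%g == r) (p, q) H) i.
  rewrite !dsum_in_id; exact: tensor_actE.
by rewrite !dsum_in_neq // linear0.
Qed.

Lemma gtens_ind r (P : gtensor M N r -> Prop) :
    P 0 -> (forall x y, P x -> P y -> P (x + y)) ->
    (forall p q (H : (p * q)%g == r) m n, P (gtens H m n)) ->
  forall t, P t.
Proof.
move=> P0 PD Pt t; rewrite [t]dsum_sumE.
elim/big_ind: _ => // -[[p q] /= H] _.
have [c ->] := tens_gen (t (exist _ (p, q) H)).
rewrite linear_sum; elim/big_ind: _ => // i _.
rewrite linear_sum; elim/big_ind: _ => // j _.
rewrite linearZ /= -[dsum_in _]/(gtens_def H _ _).
by rewrite -gtensE -gtensZl; apply: Pt.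
Qed.

Lemma gtens_ext r (W : vectType k) (g h : 'Hom(gtensor M N r, W)) :
  (forall p q (H : (p * q)%g == r) m n, g (gtens H m n) = h (gtens H m n)) ->
  g =1 h.
Proof.
move=> gh; apply: gtens_ind => [|x y gx gy|//]; first by rewrite !linear0.
by rewrite !linearD /= gx gy.
Qed.

Section GLift.
Variables (r : Q) (W : vectType k).
Variable b : forall p q, (p * q)%g == r -> M p -> N q -> W.

Definition gbalanced := forall p q (H : (p * q)%g == r),
  [/\ forall n, linear ((b H)^~ n), forall m, linear (b H m)
    & forall a m n, b H (rep_act (M p) a m) n
                    = b H m (rep_act (N q) (phi p^-1%g a) n)].

(* The linear map with gtens H m n |-> b H m n, provided b is balanced.       *)
Definition glift_fun (x : gtensor M N r) : W :=
  \sum_(i : gsplit r)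
    tlift (M := M (val i).1)
      (N := rep_twist (aut_mul phi (val i).1^-1%g) (N (val i).2))
      (b (valP i)) ((x : dsum _) i).
Lemma glift_fun_is_linear : linear glift_fun.
Proof.
move=> c x y; rewrite /glift_fun scaler_sumr -big_split.
by apply: eq_bigr => i _ /=; rewrite !ffunE linearP.
Qed.
HB.instance Definition _ :=
  GRing.isLinear.Build k _ W _ glift_fun glift_fun_is_linear.
Definition glift : 'Hom(gtensor M N r, W) := linfun glift_fun.

Lemma gliftE : gbalanced ->
  forall p q (H : (p * q)%g == r) m n, glift (gtens H m n) = b H m n.
Proof.
move=> hb p q H m n; rewrite lfunE /= /glift_fun gtensE /gtens_def.
rewrite (bigD1 (exist (fun pq : Q * Q => (pq.1 * pq.2)%g == r) (p, q) H)) //=.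
rewrite big1 ?addr0 => [|i ij]; last first.
  by rewrite dsum_in_neq 1?eq_sym // linear0.
rewrite dsum_in_id tliftE; first by congr (b _ m n); exact: bool_irrelevance.
set i := exist _ _ _; by have [bl br ba] := hb _ _ (valP i); split.
Qed.

End GLift.
End GTensor.

(* f ⊗ g : gtens H m n |-> gtens H (f m) (g n)                               *)
Section GTensorMap.
Variables (M M' N N' : grep) (f : ghom M M') (g : ghom N N').

Definition gmap_fun r : 'Hom(gtensor M N r, gtensor M' N' r) :=
  glift (fun p q (H : (p * q)%g == r) m n => gtens H (f p m) (g q n)).

Lemma gmap_funE p q r (H : (p * q)%g == r) m n :
  gmap_fun r (gtens H m n) = gtens H (f p m) (g q n).
Proof.
rewrite gliftE // => {p q H m n} p q H; split=> [n c x y|m c x y|a m n].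
- by rewrite linearP gtensDl gtensZl.
- by rewrite linearP gtensDr gtensZr.
- by rewrite !rep_homE gtens_act.
Qed.

Lemma gmap_equivariant r : equivariant (gmap_fun r).
Proof.
apply/equivariantP=> a t.
rewrite -[LHS]comp_lfunE -[RHS]comp_lfunE; apply: gtens_ext => p q H m n.
by rewrite !comp_lfunE gact_tens !gmap_funE gact_tens rep_homE.
Qed.

Definition gmap : ghom (gtensor M N) (gtensor M' N') :=
  fun r => RepHom (gmap_equivariant r).

Lemma gmapE p q r (H : (p * q)%g == r) m n :
  gmap r (gtens H m n) = gtens H (f p m) (g q n).
Proof. exact: gmap_funE. Qed.

End GTensorMap.

(* (m ⊗ n) ⊗ y |-> m ⊗ (n ⊗ y)                                             *)
Section Associator.
Variables M N P : grep.

Lemma assoc_deg (p q r x s : Q) :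
  (p * q)%g == r -> (r * x)%g == s -> (p * (q * x))%g == s.
Proof. by move=> /eqP <-; rewrite mulgA. Qed.
Lemma assocV_deg (p q x u s : Q) :
  (q * x)%g == u -> (p * u)%g == s -> ((p * q) * x)%g == s.
Proof. by move=> /eqP <-; rewrite mulgA. Qed.

Definition gassoc_in s r x (H : (r * x)%g == s) (y : P x) :
    'Hom(gtensor M N r, gtensor M (gtensor N P) s) :=
  glift (fun p q (H' : (p * q)%g == r) m n =>
           gtens (assoc_deg H' H) m (gtens (eqxx (q * x)%g) n y)).
Definition gassoc_fun s :
    'Hom(gtensor (gtensor M N) P s, gtensor M (gtensor N P) s) :=
  glift (fun r x (H : (r * x)%g == s) t y => gassoc_in H y t).

Definition gassocV_in s p u (H : (p * u)%g == s) (m : M p) :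
    'Hom(gtensor N P u, gtensor (gtensor M N) P s) :=
  glift (fun q x (H' : (q * x)%g == u) n y =>
           gtens (assocV_deg H' H) (gtens (eqxx (p * q)%g) m n) y).
Definition gassocV_fun s :
    'Hom(gtensor M (gtensor N P) s, gtensor (gtensor M N) P s) :=
  glift (fun p u (H : (p * u)%g == s) m t => gassocV_in H m t).

Lemma gassoc_inE s r x (H : (r * x)%g == s) y p q (H' : (p * q)%g == r) m n :
  gassoc_in H y (gtens H' m n)
    = gtens (assoc_deg H' H) m (gtens (eqxx (q * x)%g) n y).
Proof.
rewrite gliftE // => {p q H' m n} p q H'; split=> [n c m m'|m c n n'|a m n].
- by rewrite gtensDl gtensZl.
- by rewrite gtensDl gtensZl gtensDr gtensZr.
- by rewrite gtens_act gact_tens.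
Qed.

Lemma gassocV_inE s p u (H : (p * u)%g == s) m q x (H' : (q * x)%g == u) n y :
  gassocV_in H m (gtens H' n y)
    = gtens (assocV_deg H' H) (gtens (eqxx (p * q)%g) m n) y.
Proof.
rewrite gliftE // => {q x H' n y} q x H'; split=> [y c n n'|n c y y'|a n y].
- by rewrite gtensDr gtensZr gtensDl gtensZl.
- by rewrite gtensDr gtensZr.
- rewrite -[a in rep_act (N q) a](aut_act1 phi) -(mulVg p) aut_actM.
  by rewrite -gtens_act -gact_tens gtens_act -aut_actM invMg mulgKV.
Qed.

Lemma gassoc_in_linear s r x (H : (r * x)%g == s) c y y' t :
  gassoc_in H (c *: y + y') t = c *: gassoc_in H y t + gassoc_in H y' t.
Proof.
rewrite -lfun_combE.
move: t; apply: gtens_ext => p q H' m n.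
by rewrite lfun_combE !gassoc_inE !(gtensDr, gtensZr).
Qed.

Lemma gassoc_in_act s r x (H : (r * x)%g == s) a y t :
  gassoc_in H y (rep_act (gtensor M N r) a t)
    = gassoc_in H (rep_act (P x) (phi r^-1%g a) y) t.
Proof.
rewrite -[LHS]comp_lfunE; move: t; apply: gtens_ext => p q H' m n.
rewrite comp_lfunE gact_tens !gassoc_inE gtens_act gact_tens gtens_act.
by rewrite -aut_actM -invMg (eqP H').
Qed.

Lemma gassocV_in_linear s p u (H : (p * u)%g == s) c m m' t :
  gassocV_in H (c *: m + m') t = c *: gassocV_in H m t + gassocV_in H m' t.
Proof.
rewrite -lfun_combE.
move: t; apply: gtens_ext => q x H' n y.
by rewrite lfun_combE !gassocV_inE !(gtensDl, gtensZl).
Qed.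

Lemma gassocV_in_act s p u (H : (p * u)%g == s) a m t :
  gassocV_in H (rep_act (M p) a m) t
    = gassocV_in H m (rep_act (gtensor N P u) (phi p^-1%g a) t).
Proof.
rewrite -[RHS]comp_lfunE; move: t; apply: gtens_ext => q x H' n y.
by rewrite comp_lfunE gact_tens !gassocV_inE gtens_act.
Qed.

Lemma gassoc_funE s r x (H : (r * x)%g == s) t y :
  gassoc_fun s (gtens H t y) = gassoc_in H y t.
Proof.
rewrite gliftE // => {r x H t y} r x H; split=> [y c t t'|t c y y'|a t y].
- exact: linearP.
- exact: gassoc_in_linear.
- exact: gassoc_in_act.
Qed.

Lemma gassocV_funE s p u (H : (p * u)%g == s) m t :
  gassocV_fun s (gtens H m t) = gassocV_in H m t.
Proof.
rewrite gliftE // => {p u H m t} p u H; split=> [t c m m'|m c t t'|a m t].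
- exact: gassocV_in_linear.
- exact: linearP.
- exact: gassocV_in_act.
Qed.

Lemma gassoc_equivariant s : equivariant (gassoc_fun s).
Proof.
apply/equivariantP=> a t; rewrite -[LHS]comp_lfunE -[RHS]comp_lfunE.
move: t; apply: gtens_ext => r x H t y.
rewrite !comp_lfunE gact_tens !gassoc_funE -[LHS]comp_lfunE -[RHS]comp_lfunE.
move: t; apply: gtens_ext => p q H' m n.
by rewrite !comp_lfunE gact_tens !gassoc_inE gact_tens.
Qed.
Lemma gassocV_equivariant s : equivariant (gassocV_fun s).
Proof.
apply/equivariantP=> a t; rewrite -[LHS]comp_lfunE -[RHS]comp_lfunE.
move: t; apply: gtens_ext => p u H m t.
rewrite !comp_lfunE gact_tens !gassocV_funE -[RHS]comp_lfunE.
move: t; apply: gtens_ext => q x H' n y.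
by rewrite comp_lfunE !gassocV_inE !gact_tens.
Qed.

Definition gassoc : ghom (gtensor (gtensor M N) P) (gtensor M (gtensor N P)) :=
  fun s => RepHom (gassoc_equivariant s).
Definition gassocV : ghom (gtensor M (gtensor N P)) (gtensor (gtensor M N) P) :=
  fun s => RepHom (gassocV_equivariant s).

Lemma gassocE s r x p q (H : (r * x)%g == s) (H' : (p * q)%g == r) m n y :
  gassoc s (gtens H (gtens H' m n) y)
    = gtens (assoc_deg H' H) m (gtens (eqxx (q * x)%g) n y).
Proof. by rewrite /= gassoc_funE gassoc_inE. Qed.
Lemma gassocVE s p u q x (H : (p * u)%g == s) (H' : (q * x)%g == u) m n y :
  gassocV s (gtens H m (gtens H' n y))
    = gtens (assocV_deg H' H) (gtens (eqxx (p * q)%g) m n) y.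
Proof. by rewrite /= gassocV_funE gassocV_inE. Qed.

End Associator.

Arguments gassoc M N P q : clear implicits.
Arguments gassocV M N P q : clear implicits.

(* kA in degree 1, and zero in all other degrees.                             *)
Definition gunit : grep :=
  fun q => if q == 1%g then rep_reg k A else rep_zero k A.

Definition gunit_out q : gunit q -> {ffun A -> k^o} :=
  (if q == 1%g as b
     return (if b then rep_reg k A else rep_zero k A) -> {ffun A -> k^o}
   then fun x => x else fun _ => 0).
Definition gunit_in q : {ffun A -> k^o} -> gunit q :=
  (if q == 1%g as b
     return {ffun A -> k^o} -> (if b then rep_reg k A else rep_zero k A)
   then fun x => x else fun _ => 0).

Lemma gunit_out_is_linear q : linear (@gunit_out q).
Proof.
rewrite /gunit_out /gunit => c; case: (q == 1%g) => x y //.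
by rewrite scaler0 addr0.
Qed.
HB.instance Definition _ q :=
  GRing.isLinear.Build k _ _ _ (@gunit_out q) (@gunit_out_is_linear q).
Lemma gunit_in_is_linear q : linear (@gunit_in q).
Proof.
rewrite /gunit_in /gunit => c; case: (q == 1%g) => x y //.
by rewrite scaler0 addr0.
Qed.
HB.instance Definition _ q :=
  GRing.isLinear.Build k _ _ _ (@gunit_in q) (@gunit_in_is_linear q).

Lemma gunit_outK q : cancel (@gunit_out q) (@gunit_in q).
Proof.
rewrite /gunit_out /gunit_in /gunit; case: (q == 1%g) => //= x.
by apply/matrixP=> i [].
Qed.
Lemma gunit_inK x : gunit_out (gunit_in 1%g x) = x.
Proof. by rewrite /gunit_out /gunit_in eqxx. Qed.
Lemma gunit_out_neq q (x : gunit q) : q != 1%g -> gunit_out x = 0.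
Proof. by move: x; rewrite /gunit_out /gunit; case: (q == 1%g). Qed.
Lemma gunit_outE q a (x : gunit q) b :
  gunit_out (rep_act (gunit q) a x) b = gunit_out x (a^-1 * b)%g.
Proof.
move: x; rewrite /gunit_out /gunit; case: (q == 1%g) => x.
  by rewrite rep_regE.
by rewrite !ffunE.
Qed.

(* The identity M_p -> M_r if p = r, and 0 otherwise.                         *)
Definition gcast (M : grep) p r : 'Hom(M p, M r) :=
  match (p =P r) with
  | ReflectT e => eq_rect p (fun r => 'Hom(M p, M r)) \1%VF r e
  | ReflectF _ => 0
  end.
Lemma gcast_id M p m : gcast M p p m = m.
Proof. by rewrite /gcast; case: eqP => // e; rewrite (eq_axiomK e) /= id_lfunE. Qed.
Lemma gcast_act M p r a m :
  gcast M p r (rep_act (M p) a m) = rep_act (M r) a (gcast M p r m).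
Proof.
have [<-|pr] := eqVneq p r; first by rewrite !gcast_id.
by move: pr; rewrite /gcast; case: eqP => // _ _; rewrite !zero_lfunE linear0.
Qed.
Lemma gcast_nat M N (f : ghom M N) p r m :
  f r (gcast M p r m) = gcast N p r (f p m).
Proof.
have [<-|pr] := eqVneq p r; first by rewrite !gcast_id.
by move: pr; rewrite /gcast; case: eqP => // _ _; rewrite !zero_lfunE linear0.
Qed.

(* The action of x in kA on v, with a in A acting as s a.                     *)
Definition alg_act (V : rep k A) (s : A -> A) (x : {ffun A -> k^o}) (v : V) : V :=
  \sum_a x a *: rep_act V (s a) v.

Lemma alg_act_linl (V : rep k A) s (v : V) : linear (fun x => alg_act s x v).
Proof.
move=> c x y; rewrite /alg_act scaler_sumr -big_split; apply: eq_bigr => a _ /=.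
by rewrite !ffunE scalerDl scalerA.
Qed.
Lemma alg_act_linr (V : rep k A) s x : linear (@alg_act V s x).
Proof.
move=> c u v; rewrite /alg_act scaler_sumr -big_split; apply: eq_bigr => a _ /=.
by rewrite linearP scalerDr !scalerA mulrC.
Qed.
Lemma alg_act0 (V : rep k A) s (v : V) : alg_act s 0 v = 0.
Proof. by rewrite /alg_act big1 // => a _; rewrite ffunE scale0r. Qed.
Lemma alg_act_act (V : rep k A) s x a (v : V) :
  alg_act s x (rep_act V a v) = rep_act V a (alg_act s x v).
Proof.
rewrite /alg_act linear_sum; apply: eq_bigr => b _ /=.
by rewrite linearZ /= -!rep_actME cA.
Qed.
Lemma alg_act_reg (V : rep k A) (s : A -> A) (x y : {ffun A -> k^o}) a (v : V) :
    {morph s : b c / (b * c)%g} -> (forall b, y b = x (a^-1 * b)%g) ->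
  alg_act s y v = rep_act V (s a) (alg_act s x v).
Proof.
move=> sM yx; rewrite /alg_act linear_sum (reindex_inj (mulgI a)) /=.
by apply: eq_bigr => b _; rewrite linearZ /= yx mulKg sM rep_actME.
Qed.
Lemma alg_act_nat (V W : rep k A) s x (f : rep_hom V W) v :
  f (alg_act s x v) = alg_act s x (f v).
Proof.
rewrite /alg_act linear_sum; apply: eq_bigr => b _ /=.
by rewrite linearZ /= rep_homE.
Qed.

Definition kA1 : {ffun A -> k^o} := [ffun a => (a == 1%g)%:R].

Lemma alg_act1 (V : rep k A) s (v : V) :
  s 1%g = 1%g -> alg_act s kA1 v = v.
Proof.
move=> s1; rewrite /alg_act (bigD1 1%g) //= big1 => [|a /negPf na].
  by rewrite ffunE eqxx scale1r s1 rep_act1E addr0.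
by rewrite ffunE na scale0r.
Qed.
Lemma aut_fun1 p : phi p 1%g = 1%g.
Proof. by apply: (mulgI (phi p 1%g)); rewrite -aut_mul !mulg1. Qed.

(* x = (\sum_a x(a) a) 1 in kA                                                *)
Lemma gunit_alg_act q (x : gunit q) : q = 1%g ->
  alg_act id (gunit_out x) (gunit_in q kA1) = x.
Proof.
move=> q1; subst q; rewrite -[RHS]gunit_outK -[LHS]gunit_outK.
congr gunit_in; rewrite /alg_act linear_sum; apply/ffunP=> b.
rewrite sum_ffunE (bigD1 b) //= big1 => [|a ab].
  rewrite linearZ ffunE /= gunit_outE gunit_inK ffunE mulVg eqxx.
  by rewrite addr0 [_ *: _]mulr1.
rewrite linearZ ffunE /= gunit_outE gunit_inK ffunE.
case: eqP => [/(congr1 (mulg a))|_]; last by rewrite [_ *: _]mulr0.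
by rewrite mulKVg mulg1 => ba; rewrite ba eqxx in ab.
Qed.

Section Unitors.
Variable M : grep.

(* x ⊗ n |-> x n                                                             *)
Definition glunit_fun r : 'Hom(gtensor gunit M r, M r) :=
  glift (fun p q (_ : (p * q)%g == r) x n =>
           gcast M q r (alg_act id (gunit_out x) n)).
(* m ⊗ x |-> (phi_p x) m, for m of degree p                                  *)
Definition grunit_fun r : 'Hom(gtensor M gunit r, M r) :=
  glift (fun p q (_ : (p * q)%g == r) m x =>
           gcast M p r (alg_act (phi p) (gunit_out x) m)).

Definition glunitV_fun r : 'Hom(M r, gtensor gunit M r) :=
  linfun (gtens (N := M) (introT eqP (mul1g r)) (gunit_in 1%g kA1)).
Definition grunitV_fun r : 'Hom(M r, gtensor M gunit r) :=
  linfun ((gtens (M := M) (introT eqP (mulg1 r)))^~ (gunit_in 1%g kA1)).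

Lemma glunit_funE p q r (H : (p * q)%g == r) x n :
  glunit_fun r (gtens H x n) = gcast M q r (alg_act id (gunit_out x) n).
Proof.
rewrite gliftE // => {p q H x n} p q H; split=> [n c x y|x c n n'|a x n].
- by rewrite linearP alg_act_linl linearP.
- by rewrite alg_act_linr linearP.
- have [p1|np] := eqVneq p 1%g; last first.
    by rewrite !gunit_out_neq // !alg_act0.
  subst p; rewrite invg1 aut_act1 alg_act_act -(@alg_act_reg _ id _ _ _ _ _
    (gunit_outE a x)) //.
Qed.

Lemma grunit_funE p q r (H : (p * q)%g == r) m x :
  grunit_fun r (gtens H m x) = gcast M p r (alg_act (phi p) (gunit_out x) m).
Proof.
rewrite gliftE // => {p q H m x} p q H; split=> [x c m m'|m c x y|a m x].
- by rewrite alg_act_linr linearP.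
- by rewrite linearP alg_act_linl linearP.
- rewrite alg_act_act (alg_act_reg _ (aut_mul phi p) (gunit_outE _ x)).
  by rewrite -aut_actM mulgV aut_act1.
Qed.

Lemma glunitV_funE r m : glunitV_fun r m
  = gtens (introT eqP (mul1g r)) (gunit_in 1%g kA1) m.
Proof.
have lin : linear (gtens (N := M) (introT eqP (mul1g r)) (gunit_in 1%g kA1)).
  by move=> c x y; rewrite gtensDr gtensZr.
exact: (linfun_linE lin).
Qed.
Lemma grunitV_funE r m : grunitV_fun r m
  = gtens (introT eqP (mulg1 r)) m (gunit_in 1%g kA1).
Proof.
have lin : linear ((gtens (M := M) (introT eqP (mulg1 r)))^~ (gunit_in 1%g kA1)).
  by move=> c x y; rewrite gtensDl gtensZl.
exact: (linfun_linE lin).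
Qed.

Lemma glunit_equivariant r : equivariant (glunit_fun r).
Proof.
apply/equivariantP=> a t; rewrite -[LHS]comp_lfunE -[RHS]comp_lfunE.
move: t; apply: gtens_ext => p q H x n.
rewrite !comp_lfunE gact_tens !glunit_funE -gcast_act.
by rewrite (@alg_act_reg _ id _ _ _ _ _ (gunit_outE a x)).
Qed.
Lemma grunit_equivariant r : equivariant (grunit_fun r).
Proof.
apply/equivariantP=> a t; rewrite -[LHS]comp_lfunE -[RHS]comp_lfunE.
move: t; apply: gtens_ext => p q H m x.
by rewrite !comp_lfunE gact_tens !grunit_funE -gcast_act alg_act_act.
Qed.
Lemma glunitV_equivariant r : equivariant (glunitV_fun r).
Proof.
apply/equivariantP=> a m; rewrite !glunitV_funE gact_tens.
by rewrite gtens_act invg1 aut_act1.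
Qed.
Lemma grunitV_equivariant r : equivariant (grunitV_fun r).
Proof. by apply/equivariantP=> a m; rewrite !grunitV_funE gact_tens. Qed.

Definition glunit : ghom (gtensor gunit M) M :=
  fun r => RepHom (glunit_equivariant r).
Definition glunitV : ghom M (gtensor gunit M) :=
  fun r => RepHom (glunitV_equivariant r).
Definition grunit : ghom (gtensor M gunit) M :=
  fun r => RepHom (grunit_equivariant r).
Definition grunitV : ghom M (gtensor M gunit) :=
  fun r => RepHom (grunitV_equivariant r).

Lemma glunitE p q r (H : (p * q)%g == r) x n :
  glunit r (gtens H x n) = gcast M q r (alg_act id (gunit_out x) n).
Proof. exact: glunit_funE. Qed.
Lemma grunitE p q r (H : (p * q)%g == r) m x :
  grunit r (gtens H m x) = gcast M p r (alg_act (phi p) (gunit_out x) m).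
Proof. exact: grunit_funE. Qed.
Lemma glunitVE r m :
  glunitV r m = gtens (introT eqP (mul1g r)) (gunit_in 1%g kA1) m.
Proof. exact: glunitV_funE. Qed.
Lemma grunitVE r m :
  grunitV r m = gtens (introT eqP (mulg1 r)) m (gunit_in 1%g kA1).
Proof. exact: grunitV_funE. Qed.

Lemma gtens_gunit_l p q r (H : (p * q)%g == r) (x : gunit p) (n : M q) :
  gtens (introT eqP (mul1g r)) (gunit_in 1%g kA1)
    (gcast M q r (alg_act id (gunit_out x) n)) = gtens H x n.
Proof.
have [p1|np] := eqVneq p 1%g; last first.
  rewrite -[x in RHS]gunit_outK gunit_out_neq // linear0.
  by rewrite alg_act0 linear0 gtens0l gtens0r.
subst p; have rq : q = r by rewrite -(eqP H) mul1g.
subst r; rewrite gcast_id (bool_irrelevance (introT eqP (mul1g q)) H).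
rewrite -[in RHS](gunit_alg_act x erefl) /alg_act.
elim/big_rec2: _ => [|a u v _ IH].
  by rewrite gtens0l gtens0r.
rewrite gtensDr gtensDl gtensZr gtensZl IH; congr (_ *: _ + _).
by rewrite gtens_act invg1 aut_act1.
Qed.

Lemma gtens_gunit_r p q r (H : (p * q)%g == r) (m : M p) (x : gunit q) :
  gtens (introT eqP (mulg1 r)) (gcast M p r (alg_act (phi p) (gunit_out x) m))
    (gunit_in 1%g kA1) = gtens H m x.
Proof.
have [q1|nq] := eqVneq q 1%g; last first.
  rewrite -[x in RHS]gunit_outK gunit_out_neq // linear0.
  by rewrite alg_act0 linear0 gtens0l gtens0r.
subst q; have rp : p = r by rewrite -(eqP H) mulg1.
subst r; rewrite gcast_id (bool_irrelevance (introT eqP (mulg1 p)) H).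
rewrite -[in RHS](gunit_alg_act x erefl) /alg_act.
elim/big_rec2: _ => [|a u v _ IH].
  by rewrite gtens0l gtens0r.
rewrite gtensDr gtensDl gtensZr gtensZl IH; congr (_ *: _ + _).
by rewrite gtens_act -aut_actM mulVg aut_act1.
Qed.

End Unitors.

Lemma gmap_id M N : gmap (gid M) (gid N) = gid (gtensor M N).
Proof.
apply: ghom_eq => r; apply: gtens_ext => p q H m n.
by rewrite gmapE !rep_idE.
Qed.

Lemma gmap_comp M M' M'' N N' N'' (f : ghom M M') (f' : ghom M' M'')
    (g : ghom N N') (g' : ghom N' N'') :
  gmap (gcomp f' f) (gcomp g' g) = gcomp (gmap f' g') (gmap f g).
Proof.
apply: ghom_eq => r; apply: gtens_ext => p q H m n.
by rewrite rep_compE !gmapE !rep_compE.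
Qed.

(* A linear map out of (M ⊗ N) ⊗ P, resp. M ⊗ (N ⊗ P), is determined by its  *)
(* values on pure tensors.                                                    *)
Lemma gtens3l_ext (M N P : grep) s (W : vectType k)
    (g h : 'Hom(gtensor (gtensor M N) P s, W)) :
  (forall r x p q (H : (r * x)%g == s) (H' : (p * q)%g == r) m n y,
     g (gtens H (gtens H' m n) y) = h (gtens H (gtens H' m n) y)) -> g =1 h.
Proof.
move=> gh; apply: gtens_ext => r x H t y; move: t.
apply: gtens_ind => [|t t' Ht Ht'|//].
  by rewrite gtens0l !linear0.
by rewrite gtensDl !linearD /= Ht Ht'.
Qed.
Lemma gtens3r_ext (M N P : grep) s (W : vectType k)
    (g h : 'Hom(gtensor M (gtensor N P) s, W)) :
  (forall p u q x (H : (p * u)%g == s) (H' : (q * x)%g == u) m n y,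
     g (gtens H m (gtens H' n y)) = h (gtens H m (gtens H' n y))) -> g =1 h.
Proof.
move=> gh; apply: gtens_ext => p u H m t; move: t.
apply: gtens_ind => [|t t' Ht Ht'|//].
  by rewrite gtens0r !linear0.
by rewrite gtensDr !linearD /= Ht Ht'.
Qed.

Lemma gassocK M N P : gcomp (gassocV M N P) (gassoc M N P) = gid _.
Proof.
apply: ghom_eq => s; apply: gtens3l_ext => r x p q H H' m n y.
rewrite rep_compE rep_idE gassocE gassocVE.
have r_pq := eqP H'; subst r.
by rewrite (bool_irrelevance (eqxx _) H') (bool_irrelevance (assocV_deg _ _) H).
Qed.
Lemma gassocVK M N P : gcomp (gassoc M N P) (gassocV M N P) = gid _.
Proof.
apply: ghom_eq => s; apply: gtens3r_ext => p u q x H H' m n y.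
rewrite rep_compE rep_idE gassocVE gassocE.
have u_qx := eqP H'; subst u.
by rewrite (bool_irrelevance (eqxx _) H') (bool_irrelevance (assoc_deg _ _) H).
Qed.

Lemma glunitK M : gcomp (glunitV M) (glunit M) = gid _.
Proof.
apply: ghom_eq => r; apply: gtens_ext => p q H x n.
by rewrite rep_compE rep_idE glunitE glunitVE gtens_gunit_l.
Qed.
Lemma glunitVK M : gcomp (glunit M) (glunitV M) = gid _.
Proof.
apply: ghom_eq => r m; rewrite rep_compE rep_idE glunitVE glunitE gcast_id.
by rewrite gunit_inK alg_act1.
Qed.
Lemma grunitK M : gcomp (grunitV M) (grunit M) = gid _.
Proof.
apply: ghom_eq => r; apply: gtens_ext => p q H m x.
by rewrite rep_compE rep_idE grunitE grunitVE gtens_gunit_r.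
Qed.
Lemma grunitVK M : gcomp (grunit M) (grunitV M) = gid _.
Proof.
apply: ghom_eq => r m; rewrite rep_compE rep_idE grunitVE grunitE gcast_id.
by rewrite gunit_inK alg_act1 // aut_fun1.
Qed.

Lemma gassoc_nat M M' N N' P P'
    (f : ghom M M') (g : ghom N N') (h : ghom P P') :
  gcomp (gassoc M' N' P') (gmap (gmap f g) h)
    = gcomp (gmap f (gmap g h)) (gassoc M N P).
Proof.
apply: ghom_eq => s; apply: gtens3l_ext => r x p q H H' m n y.
by rewrite !rep_compE !(gmapE, gassocE).
Qed.

Lemma glunit_nat M N (f : ghom M N) :
  gcomp (glunit N) (gmap (gid gunit) f) = gcomp f (glunit M).
Proof.
apply: ghom_eq => r; apply: gtens_ext => p q H x n.
rewrite !rep_compE gmapE !glunitE gcast_nat alg_act_nat.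
by rewrite rep_idE.
Qed.
Lemma grunit_nat M N (f : ghom M N) :
  gcomp (grunit N) (gmap f (gid gunit)) = gcomp f (grunit M).
Proof.
apply: ghom_eq => r; apply: gtens_ext => p q H m x.
rewrite !rep_compE gmapE !grunitE gcast_nat alg_act_nat.
by rewrite rep_idE.
Qed.

Lemma gtens_degE (M N P : grep) (p q x s u v : Q)
    (H : (p * u)%g == s) (K : (q * x)%g == u)
    (H' : (p * v)%g == s) (K' : (q * x)%g == v) (m : M p) (n : N q) (y : P x) :
  gtens H m (gtens K n y) = gtens H' m (gtens K' n y).
Proof.
have uE := eqP K; subst u; have vE := eqP K'; subst v.
by rewrite (bool_irrelevance H H') (bool_irrelevance K K').
Qed.

Lemma gpentagon M N P R :
  gcomp (gassoc M N (gtensor P R)) (gassoc (gtensor M N) P R)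
  = gcomp (gcomp (gmap (gid M) (gassoc N P R)) (gassoc M (gtensor N P) R))
      (gmap (gassoc M N P) (gid R)).
Proof.
apply: ghom_eq => s; apply: gtens_ext => u w Hu t z; move: t.
apply: gtens_ind => [|t t' Ht Ht'|r x H t y].
- by rewrite gtens0l !linear0.
- by rewrite gtensDl !linearD /= Ht Ht'.
move: t; apply: gtens_ind => [|t t' Ht Ht'|p q H' m n].
- by rewrite !gtens0l !linear0.
- by rewrite !gtensDl !linearD /= Ht Ht'.
rewrite [LHS]rep_compE gassocE gassocE [RHS]rep_compE gmapE gassocE rep_idE.
rewrite rep_compE gassocE gmapE rep_idE gassocE.
exact: gtens_degE.
Qed.

Lemma gtriangle M N :
  gcomp (gmap (gid M) (glunit N)) (gassoc M gunit N) = gmap (grunit M) (gid N).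
Proof.
apply: ghom_eq => s; apply: gtens3l_ext => r x p q H H' m e n.
rewrite rep_compE gassocE !gmapE glunitE grunitE !rep_idE.
have [q1|nq] := eqVneq q 1%g; last first.
  by rewrite gunit_out_neq // !alg_act0 !linear0 gtens0l gtens0r.
subst q; have r_p : p = r by rewrite -(eqP H') mulg1.
subst r; move: (assoc_deg H' H); rewrite mul1g => K.
rewrite !gcast_id (bool_irrelevance K H) /alg_act.
elim/big_rec2: _ => [|a u v _ IH]; first by rewrite gtens0l gtens0r.
rewrite gtensDr gtensDl gtensZr gtensZl IH gtens_act.
by rewrite -aut_actM mulVg aut_act1.
Qed.

Definition graded_rep : monoidal_category :=
  @MonoidalCategory gcat gtensor gmap gunit gassoc gassocV glunit glunitV
    grunit grunitV gmap_id gmap_comp gassocK gassocVK glunitK glunitVK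
    grunitK grunitVK gassoc_nat glunit_nat grunit_nat gpentagon gtriangle.

End Graded.

(* alpha : G -> Aut(H) is given as the left action g, h |-> alpha(g)h rather  *)
(* than as a morphism into Aut [set: hT] : {group {perm hT}}, because         *)
(* products in {perm hT} compose from left to right.                          *)
Record crossed_module (gT hT : finGroupType) := CrossedModule {
  cm_t : {morphism [set: hT] >-> gT};
  cm_alpha : aut_action gT hT;
  cm_equivariance : forall g h, cm_t (cm_alpha g h) = (g * cm_t h * g^-1)%g;
  cm_peiffer : forall l h, cm_alpha (cm_t l) h = (l * h * l^-1)%g }.

Section CrossedModule.
Variables (gT hT : finGroupType) (X : crossed_module gT hT).
Local Notation t := (cm_t X).
Local Notation alpha := (cm_alpha X).

Definition cm_K : {group gT} := (t @* [set: hT])%G.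
Definition cm_L : {group hT} := ('ker t)%G.

Lemma cm_tM x y : t (x * y)%g = (t x * t y)%g.
Proof. by rewrite morphM ?inE. Qed.

Lemma cm_LE l : (l \in cm_L) = (t l == 1%g).
Proof. by rewrite !inE. Qed.

Lemma cm_KP g : reflect (exists h, g = t h) (g \in cm_K).
Proof.
apply: (iffP morphimP) => [[h _ _ ->]|[h ->]]; first by exists h.
by exists h; rewrite ?inE.
Qed.

Lemma cm_L_alpha g l : l \in cm_L -> alpha g l \in cm_L.
Proof.
by rewrite !cm_LE cm_equivariance => /eqP ->; rewrite mulg1 mulgV.
Qed.

Lemma cm_L_central l h : l \in cm_L -> (l * h = h * l)%g.
Proof.
rewrite cm_LE => /eqP tl; have := cm_peiffer X l h; rewrite tl aut_act1.
by move=> /(congr1 (fun x => x * l)%g); rewrite mulgKV.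
Qed.

Lemma cm_K_normal : (cm_K <| [set: gT])%g.
Proof.
rewrite /normal subsetT; apply/normsP=> g _; apply/setP=> x.
rewrite mem_conjg; apply/cm_KP/cm_KP => -[h e].
  by exists (alpha g^-1%g h); rewrite cm_equivariance -e conjgE !invgK !mulgA
    mulVg mul1g mulgKV.
by exists (alpha g h); rewrite cm_equivariance e conjgE invgK !mulgA.
Qed.

(* Q = G / K: as K is normal in G, coset_of K is all of G / K.                *)
Definition cm_Q : finGroupType := coset_of cm_K.

Definition cm_Lt : finGroupType := subg_of cm_L.

Lemma cm_Lt_comm : forall a b : cm_Lt, (a * b = b * a)%g.
Proof. by move=> a b; apply: val_inj => /=; apply: cm_L_central; apply: subgP. Qed.

(* alpha-bar, computed on a chosen representative; cm_abarE shows that the    *)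
(* choice does not matter.                                                    *)
Definition cm_abar_fun (q : cm_Q) (l : cm_Lt) : cm_Lt :=
  subg cm_L (alpha (repr q) (sgval l)).

Lemma cm_coset q : q = coset cm_K (repr q) :> cm_Q.
Proof. by rewrite coset_reprK. Qed.

Lemma cm_norm g : g \in 'N(cm_K)%g.
Proof. by apply: (subsetP (normal_norm cm_K_normal)); rewrite inE. Qed.

Lemma cm_abarE g l :
  cm_abar_fun (coset cm_K g) l = subg cm_L (alpha g (sgval l)).
Proof.
congr subg.
have: repr (coset cm_K g) \in (cm_K :* g)%g.
  by rewrite -(val_coset (cm_norm g)) mem_repr_coset.
case/rcosetP=> _ /cm_KP[h ->] ->; rewrite aut_actM cm_peiffer.
by rewrite -(cm_L_central _ (cm_L_alpha g (subgP l))) mulgK.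
Qed.

Lemma cm_sgval_abar g l :
  sgval (cm_abar_fun (coset cm_K g) l) = alpha g (sgval l).
Proof. by rewrite cm_abarE subgK // cm_L_alpha ?subgP. Qed.

Lemma cm_abar_mul q a b :
  cm_abar_fun q (a * b)%g = (cm_abar_fun q a * cm_abar_fun q b)%g.
Proof.
by apply: val_inj; rewrite [q]cm_coset /= !cm_sgval_abar /= aut_mul.
Qed.

Lemma cm_abar1 a : cm_abar_fun 1%g a = a.
Proof.
apply: val_inj; rewrite /= -(morph1 (coset_morphism cm_K)) /=.
by rewrite cm_sgval_abar aut_act1.
Qed.

Lemma cm_abarM p q a :
  cm_abar_fun (p * q)%g a = cm_abar_fun p (cm_abar_fun q a).
Proof.
apply: val_inj; rewrite [p]cm_coset [q]cm_coset -morphM ?cm_norm //=.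
by rewrite !cm_sgval_abar aut_actM.
Qed.

Definition cm_abar : aut_action cm_Q cm_Lt :=
  AutAction cm_abar_mul cm_abar1 cm_abarM.

Definition RepG (k : fieldType) : monoidal_category :=
  graded_rep k cm_Lt_comm cm_abar.

End CrossedModule.

(* Main.v *)
From mathcomp Require Import all_boot all_fingroup all_algebra.
Require Import Defs.

Set Implicit Arguments.
Unset Strict Implicit.
Unset Printing Implicit Defensive.

Import GRing.Theory.
Local Open Scope ring_scope.

(** Write A for L, and let X be an object with summands X_p.  Duality in
    the graded category combines two facts: over the group algebra kA, a dual
    in degree 1 is a dual of kA-modules, so dualizable modules are finitely
    generated projective; and the trivial module is projective only if |A| is
    invertible in k.

    Necessity.  If x has trivial action, the first snake identity writes every
    m in x as a sum of terms ev(m ⊗ y) x', where ev(m ⊗ y) in kA acts on x'.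
    Since ev is A-linear and A fixes m, ev(m ⊗ y) is a multiple c (\sum_a a)
    of the norm element, which acts on x' as c |A|.  If |A| = 0 in k then m = 0
    ([right_dual_triv]).

    Sufficiency.  A k-bilinear perfect pairing b between X_p and Y_(p^-1) for
    which the action of a on X_p is adjoint to that of phi(p^-1) a on
    Y_(p^-1) yields the kA-valued evaluation
      ev(m ⊗ n) = \sum_a b(a^-1 m, n) a.
    With dual bases x_i, y_i, the coevaluation
      1 |-> |A|^-1 \sum_p \sum_i y_i ⊗ x_i
    satisfies both snake identities: each of the composites averages the
    expansion in dual bases over A ([pairing_right_dual]).  The contragredient
    DX, whose summand of degree q is Hom(X_(q^-1), k), pairs perfectly with X on
    either side, so it is a dual of X on the right ([pairing_gdual]) and on the
    left ([gdual_pairing]). *)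

(** * Elementwise snake identities *)

Section GradedDuality.

Variables (k : fieldType) (Q A : finGroupType).
Variables (cA : forall a b : A, (a * b = b * a)%g) (phi : aut_action Q A).

Local Notation grep := (grep k Q A).
Local Notation gunit := (gunit k (Q := Q) A).
Local Notation one := (gunit_in (1%g : Q) (kA1 k A)).
Local Notation tens := (gtens cA phi).
Local Notation RepQ := (graded_rep k cA phi).

Implicit Types X Y : grep.

(** [zig ev] and [zag ev] are the parts of the two snake composites that
    follow the insertion of the coevaluation; isolating them lets that element
    of Y ⊗ X be replaced by pure tensors. *)
Definition zig X Y (ev : ghom (gtensor cA phi X Y) gunit) :
    ghom (gtensor cA phi X (gtensor cA phi Y X)) X :=
  gcomp (glunit cA phi X)
    (gcomp (gmap cA phi ev (gid X)) (gassocV cA phi X Y X)).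

Definition zag X Y (ev : ghom (gtensor cA phi X Y) gunit) :
    ghom (gtensor cA phi (gtensor cA phi Y X) Y) Y :=
  gcomp (grunit cA phi Y)
    (gcomp (gmap cA phi (gid Y) ev) (gassoc cA phi Y X Y)).

Lemma zigE X Y (ev : ghom (gtensor cA phi X Y) gunit) s p u q x
    (H : (p * u)%g == s) (H' : (q * x)%g == u) (m : X p) (n : Y q) (m' : X x) :
  zig ev s (tens H m (tens H' n m'))
    = gcast X x s
        (alg_act id (gunit_out (ev _ (tens (eqxx (p * q)%g) m n))) m').
Proof. by rewrite !rep_compE gassocVE gmapE glunitE rep_idE. Qed.

Lemma zagE X Y (ev : ghom (gtensor cA phi X Y) gunit) s r x p q
    (H : (r * x)%g == s) (H' : (p * q)%g == r) (n : Y p) (m : X q) (n' : Y x) :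
  zag ev s (tens H (tens H' n m) n')
    = gcast Y p s
        (alg_act (phi p) (gunit_out (ev _ (tens (eqxx (q * x)%g) m n'))) n).
Proof. by rewrite !rep_compE gassocE gmapE grunitE rep_idE. Qed.

Lemma zig_coevE X Y (ev : ghom (gtensor cA phi X Y) gunit)
    (coev : ghom gunit (gtensor cA phi Y X)) r (m : X r) :
  gcomp (gcomp (gcomp (gcomp (glunit cA phi X) (gmap cA phi ev (gid X)))
    (gassocV cA phi X Y X)) (gmap cA phi (gid X) coev)) (grunitV cA phi X) r m
  = zig ev r (tens (introT eqP (mulg1 r)) m (coev 1%g one)).
Proof. by rewrite !rep_compE grunitVE gmapE rep_idE. Qed.

Lemma zag_coevE X Y (ev : ghom (gtensor cA phi X Y) gunit)
    (coev : ghom gunit (gtensor cA phi Y X)) r (n : Y r) :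
  gcomp (gcomp (gcomp (gcomp (grunit cA phi Y) (gmap cA phi (gid Y) ev))
    (gassoc cA phi Y X Y)) (gmap cA phi coev (gid Y))) (glunitV cA phi Y) r n
  = zag ev r (tens (introT eqP (mul1g r)) (coev 1%g one) n).
Proof. by rewrite !rep_compE glunitVE gmapE rep_idE. Qed.

(** The inverse unitors insert 1 in kA, so the snake identities are conditions
    on the single element coev(1) of Y ⊗ X. *)
Lemma snake1P X Y (ev : ghom (gtensor cA phi X Y) gunit)
    (coev : ghom gunit (gtensor cA phi Y X)) :
  @snake1 RepQ X Y ev coev <->
  (forall r (m : X r),
     zig ev r (tens (introT eqP (mulg1 r)) m (coev 1%g one)) = m).
Proof.
split=> [sn r m|sn].
  rewrite -zig_coevE.
  by move: sn => /(congr1 (fun f : ghom X X => f r m)) => ->; exact: rep_idE.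
by apply: ghom_eq => r m; rewrite [LHS]zig_coevE sn rep_idE.
Qed.

Lemma snake2P X Y (ev : ghom (gtensor cA phi X Y) gunit)
    (coev : ghom gunit (gtensor cA phi Y X)) :
  @snake2 RepQ X Y ev coev <->
  (forall r (n : Y r),
     zag ev r (tens (introT eqP (mul1g r)) (coev 1%g one) n) = n).
Proof.
split=> [sn r n|sn].
  rewrite -zag_coevE.
  by move: sn => /(congr1 (fun f : ghom Y Y => f r n)) => ->; exact: rep_idE.
by apply: ghom_eq => r n; rewrite [LHS]zag_coevE sn rep_idE.
Qed.

(** Reversing the tensor product exchanges the roles of the two objects. *)
Lemma left_dual_of_right_dual (C : monoidal_category) (x y : C) :
  right_dual y x -> left_dual x y.
Proof. by case=> ev [coev [s1 s2]]; exists ev, coev. Qed.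

(** * Necessity: the trivial representation *)

Definition rep_triv : rep k A :=
  @Rep k A k^o (fun _ => \1%VF) erefl (fun _ _ => esym (comp_lfun1l _)).

(** A fixes m, hence also ev(m ⊗ n); the invariants of kA are the multiples of
    the norm element, that is, the constant functions on A. *)
Lemma ev_triv_const Y (ev : ghom (gtensor cA phi (fun _ => rep_triv) Y) gunit)
    s p q (H : (p * q)%g == s) (m : rep_triv) (n : Y q) a b :
  gunit_out (ev s (tens H m n)) a = gunit_out (ev s (tens H m n)) b.
Proof.
have inv c d : gunit_out (ev s (tens H m n)) (c * d)%g
             = gunit_out (ev s (tens H m n)) d.
  by rewrite -{1}[c]invgK -gunit_outE -rep_homE gact_tens /= id_lfunE.
by rewrite -(mulgKV b a) inv.
Qed.

(** The object is trivial in every degree, which spares a case distinction on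
    degrees: whatever acts on it in the zigzag is a multiple of the norm
    element, and the norm element acts as |A|. *)
Lemma right_dual_triv Y :
  @right_dual RepQ (fun _ => rep_triv) Y -> (#|A|%:R : k) != 0.
Proof.
case=> ev [coev [/snake1P sn _]]; apply/eqP=> A0.
suff zig0 t : zig ev 1%g (tens (introT eqP (mulg1 1%g)) (1 : rep_triv) t) = 0.
  by have := sn 1%g (1 : rep_triv); rewrite zig0 => /esym/eqP; rewrite oner_eq0.
move: t; apply: gtens_ind => [|t t' Ht Ht'|q x H n m].
- by rewrite gtens0r linear0.
- by rewrite gtensDr linearD /= Ht Ht' addr0.
rewrite zigE /alg_act.
under eq_bigr => a _.
  rewrite (ev_triv_const _ _ _ _ a 1%g) /= id_lfunE.
  over.
by rewrite sumr_const cardT -cardE -scaler_nat A0 scale0r linear0.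
Qed.

(** * Sufficiency: duals from perfect pairings *)

Definition gunit_hom X (c : X 1%g) r : 'Hom(gunit r, X r) :=
  linfun (fun x : gunit r => gcast X 1%g r (alg_act id (gunit_out x) c)).

Lemma gunit_homE X (c : X 1%g) r x :
  gunit_hom c r x = gcast X 1%g r (alg_act id (gunit_out x) c).
Proof.
rewrite linfun_linE // => a y z.
by rewrite linearP alg_act_linl linearP.
Qed.

Lemma gunit_hom_equivariant X (c : X 1%g) r : equivariant (gunit_hom c r).
Proof.
apply/equivariantP=> a x; rewrite !gunit_homE.
by rewrite (@alg_act_reg _ _ _ id _ _ _ _ _ (gunit_outE a x)) // gcast_act.
Qed.

(** The unit is free of rank one on 1 in degree 1, so a coevaluation may be
    prescribed by an arbitrary element. *)
Definition gunit_ghom X (c : X 1%g) : ghom gunit X :=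
  fun r => RepHom (gunit_hom_equivariant c r).

Lemma gunit_ghom1 X (c : X 1%g) : gunit_ghom c 1%g one = c.
Proof. by rewrite /= gunit_homE gcast_id gunit_inK alg_act1. Qed.

Lemma gunit_in_act r a (x : {ffun A -> k^o}) :
  rep_act (gunit r) a (gunit_in r x) = gunit_in r [ffun b => x (a^-1 * b)%g].
Proof.
apply: (can_inj (@gunit_outK _ _ _ r)); apply/ffunP=> b; rewrite gunit_outE.
have [->|r1] := eqVneq r 1%g; first by rewrite !gunit_inK ffunE.
by rewrite !gunit_out_neq // !ffunE.
Qed.

(** A perfect pairing of X with Y over k, perfectness being given by the dual
    bases [dp_x], [dp_y].  The twist by phi p^-1 in [dp_act] is that of the
    tensor product X_p ⊗ Y_(p^-1), for which it makes the kA-valued form below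
    balanced. *)
Record dual_pairing X Y := DualPairing {
  dp_form : forall p, X p -> Y p^-1%g -> k^o;
  dp_linl : forall p n, linear ((@dp_form p)^~ n);
  dp_linr : forall p m, linear (@dp_form p m);
  dp_act : forall p a m n, dp_form (rep_act (X p) a m) n
                           = dp_form m (rep_act (Y p^-1%g) (phi p^-1%g a) n);
  dp_dim : Q -> nat;
  dp_x : forall p, 'I_(dp_dim p) -> X p;
  dp_y : forall p, 'I_(dp_dim p) -> Y p^-1%g;
  dp_xE : forall p m, \sum_i dp_form m (dp_y i) *: @dp_x p i = m;
  dp_yE : forall p n, \sum_i dp_form (dp_x i) n *: @dp_y p i = n }.

Arguments dp_x {X Y} d {p} i : rename.
Arguments dp_y {X Y} d {p} i : rename.

Section PairingDual.
Variables (X Y : grep) (P : dual_pairing X Y).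

(** The kA-valued form \sum_a b(a^-1 m, n) a.  Outside degree 1 the unit
    vanishes, so the casts only matter when q = p^-1. *)
Definition pair_ev p q r (_ : (p * q)%g == r) (m : X p) (n : Y q) : gunit r :=
  gunit_in r
    [ffun a => dp_form P (rep_act (X p) a^-1%g m) (gcast Y q p^-1%g n)].

Lemma pair_ev_balanced r : gbalanced phi (fun p q => @pair_ev p q r).
Proof.
move=> p q H; split=> [n c m m'|m c n n'|a m n]; rewrite /pair_ev.
- rewrite -gunit_in_is_linear; congr gunit_in; apply/ffunP=> a.
  by rewrite !ffunE linearP dp_linl.
- rewrite -gunit_in_is_linear; congr gunit_in; apply/ffunP=> a.
  by rewrite !ffunE linearP dp_linr.
congr gunit_in; apply/ffunP=> c.
by rewrite !ffunE gcast_act -dp_act -!rep_actME cA.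
Qed.

Definition ev_fun r : 'Hom(gtensor cA phi X Y r, gunit r) :=
  glift cA phi (fun p q => @pair_ev p q r).

Lemma ev_funE p q r (H : (p * q)%g == r) m n :
  ev_fun r (tens H m n) = pair_ev H m n.
Proof. by rewrite [LHS]gliftE //; exact: pair_ev_balanced. Qed.

Lemma ev_equivariant r : equivariant (ev_fun r).
Proof.
apply/equivariantP=> a t; rewrite -[LHS]comp_lfunE -[RHS]comp_lfunE.
move: t; apply: gtens_ext => p q H m n; rewrite !comp_lfunE gact_tens !ev_funE.
rewrite gunit_in_act; congr gunit_in; apply/ffunP=> b.
by rewrite !ffunE -rep_actME invMg invgK.
Qed.

Definition pairing_ev : ghom (gtensor cA phi X Y) gunit :=
  fun r => RepHom (ev_equivariant r).

Lemma gunit_out_pairing_ev p q (m : X p) (n : Y q) (a : A) : (p * q)%g = 1%g ->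
  gunit_out (pairing_ev _ (tens (eqxx (p * q)%g) m n)) a
    = dp_form P (rep_act (X p) a^-1%g m) (gcast Y q p^-1%g n).
Proof.
rewrite /= ev_funE /pair_ev => ->.
by rewrite gunit_inK ffunE.
Qed.

Definition pairing_copair : gtensor cA phi Y X 1%g :=
  #|A|%:R^-1 *:
    \sum_p \sum_i tens (introT eqP (mulVg p)) (dp_y P i) (dp_x P (p := p) i).

Lemma linear_copair (W : vectType k) (g : gtensor cA phi Y X 1%g -> W) :
    linear g ->
  g pairing_copair = #|A|%:R^-1 *:
    \sum_p \sum_i
      g (tens (introT eqP (mulVg p)) (dp_y P i) (dp_x P (p := p) i)).
Proof.
move=> lin; rewrite -(linfun_linE lin) linearZ /= linear_sum /=.
congr (_ *: _); apply: eq_bigr => p _; rewrite linear_sum.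
by apply: eq_bigr => i _; rewrite /= (linfun_linE lin).
Qed.

(** Only the summand p = r survives, and it is
      |A|^-1 \sum_a a (\sum_i b(a^-1 m, y_i) x_i)
        = |A|^-1 \sum_a a (a^-1 m) = m. *)
Lemma pairing_zig r (m : X r) : (#|A|%:R : k) != 0 ->
  zig pairing_ev r (tens (introT eqP (mulg1 r)) m pairing_copair) = m.
Proof.
move=> A0; pose g t := zig pairing_ev r (tens (introT eqP (mulg1 r)) m t).
rewrite -[LHS]/(g _) linear_copair; last first.
  by move=> c t t'; rewrite /g gtensDr gtensZr linearP.
rewrite (bigD1 r) //= [X in _ + X]big1 ?addr0 => [|p pr]; last first.
  rewrite big1 // => i _; rewrite /g zigE gunit_out_neq ?alg_act0 ?linear0 //.
  by apply: contra_neq pr => /(canRL (mulgKV _)); rewrite mul1g.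
under eq_bigr => i _.
  rewrite /g zigE gcast_id /alg_act.
  under eq_bigr => a _ do
    rewrite gunit_out_pairing_ev ?mulgV // gcast_id -linearZ.
  over.
rewrite exchange_big /=.
under eq_bigr => a _ do rewrite -linear_sum dp_xE /= -rep_actME mulgV rep_act1E.
by rewrite sumr_const cardT -cardE -scaler_nat scalerA mulVf ?scale1r.
Qed.

(** Only the summand p = r^-1 survives.  There the right unitor lets a act on
    y_i through phi(p^-1) a, while moving a^-1 across the form makes it act on n
    through phi(p^-1) a^-1: the two cancel after summing over i. *)
Lemma pairing_zag r (n : Y r) : (#|A|%:R : k) != 0 ->
  zag pairing_ev r (tens (introT eqP (mul1g r)) pairing_copair n) = n.
Proof.
(* The pairing is indexed by the degree p of X, so the degree of n is put in
   the form p^-1. *)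
move=> A0; have [p rp] : exists p, r = p^-1%g by exists r^-1%g; rewrite invgK.
subst r.
pose g t := zag pairing_ev p^-1%g (tens (introT eqP (mul1g p^-1%g)) t n).
rewrite -[LHS]/(g _) linear_copair; last first.
  by move=> c t t'; rewrite /g gtensDl gtensZl linearP.
rewrite (bigD1 p) //= [X in _ + X]big1 ?addr0 => [|q qp]; last first.
  rewrite big1 // => i _; rewrite /g zagE gunit_out_neq ?alg_act0 ?linear0 //.
  by apply: contra_neq qp => /(canRL (mulgK _)); rewrite mul1g invgK.
under eq_bigr => i _.
  rewrite /g zagE gcast_id /alg_act.
  under eq_bigr => a _ do
    rewrite gunit_out_pairing_ev ?mulgV // gcast_id dp_act -linearZ.
  over.
rewrite exchange_big /=.
under eq_bigr => a _.
  rewrite -linear_sum dp_yE /= -rep_actME -aut_mul mulgV aut_fun1 rep_act1E.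
  over.
by rewrite sumr_const cardT -cardE -scaler_nat scalerA mulVf ?scale1r.
Qed.

Lemma pairing_right_dual : (#|A|%:R : k) != 0 -> @right_dual RepQ X Y.
Proof.
move=> A0; exists pairing_ev, (gunit_ghom pairing_copair).
split; first by apply/snake1P=> r m; rewrite gunit_ghom1 pairing_zig.
by apply/snake2P=> r n; rewrite gunit_ghom1 pairing_zag.
Qed.

End PairingDual.

(** * The contragredient object *)

Section DualRep.
Variables (X : grep) (q : Q).

(** No inverse of a occurs, as A is abelian; the twist by phi q^-1 is forced by
    the adjunction [dp_act]. *)
Definition gdual_act (a : A) (f : 'Hom(X q^-1%g, k^o)) : 'Hom(X q^-1%g, k^o) :=
  (f \o rep_act (X q^-1%g) (phi q^-1%g a))%VF.

Lemma gdual_act_linear a : linear (gdual_act a).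
Proof.
move=> c f g; apply/lfunP=> m.
by rewrite /gdual_act lfun_combE !comp_lfunE lfun_combE.
Qed.

Lemma gdual_actE a f m :
  linfun (gdual_act a) f m = f (rep_act (X q^-1%g) (phi q^-1%g a) m).
Proof. by rewrite (linfun_linE (gdual_act_linear a)) comp_lfunE. Qed.

Lemma gdual_act1 : linfun (gdual_act 1%g) = \1%VF.
Proof.
apply/lfunP=> f; apply/lfunP=> m.
by rewrite gdual_actE aut_fun1 rep_act1E id_lfunE.
Qed.

Lemma gdual_actM a b :
  linfun (gdual_act (a * b)%g)
    = (linfun (gdual_act a) \o linfun (gdual_act b))%VF.
Proof.
apply/lfunP=> f; apply/lfunP=> m; rewrite comp_lfunE !gdual_actE.
by rewrite -rep_actME -aut_mul cA.
Qed.

Definition gdual_rep : rep k A := Rep gdual_act1 gdual_actM.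

End DualRep.

Definition gdual X : grep := gdual_rep X.

Lemma gdualE X q a (f : gdual X q) m :
  (rep_act (gdual X q) a f : 'Hom(X q^-1%g, k^o)) m
    = (f : 'Hom(X q^-1%g, k^o)) (rep_act (X q^-1%g) (phi q^-1%g a) m).
Proof. exact: gdual_actE. Qed.

(** * Coordinate forms and the two pairings *)

Definition coord_form (V : vectType k) i : 'Hom(V, k^o) :=
  linfun (coord (vbasis {:V}) i : V -> k^o).

Lemma coord_formE (V : vectType k) i (v : V) :
  coord_form i v = coord (vbasis {:V}) i v.
Proof. by rewrite lfunE. Qed.

Lemma coord_form_sum (V W : vectType k) (g : 'Hom(V, W)) (v : V) :
  \sum_i coord (vbasis {:V}) i v *: g (vbasis {:V})`_i = g v.
Proof.
rewrite [in RHS](coord_vbasis (memvf v)) linear_sum.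
by apply: eq_bigr => i _; rewrite linearZ.
Qed.

Lemma gcastK X p r : p = r -> cancel (gcast X p r) (gcast X r p).
Proof. by move=> <- m; rewrite !gcast_id. Qed.

Lemma gdual_pairing X : dual_pairing (gdual X) X.
Proof.
exists (fun p (f : 'Hom(X p^-1%g, k^o)) m => f m)
  (fun p => \dim {:X p^-1%g})
  (fun p i => coord_form i) (fun p i => (vbasis {:X p^-1%g})`_i).
- by move=> p m c f g; rewrite lfun_combE.
- by move=> p f c m n; rewrite linearP.
- by move=> p a f m; rewrite gdualE.
- move=> p f; apply/lfunP=> m; rewrite -[RHS]coord_form_sum sum_lfunE.
  apply: eq_bigr => i _; rewrite scale_lfunE coord_formE.
  exact: mulrC.
- move=> p m; rewrite [RHS](coord_vbasis (memvf m)).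
  by apply: eq_bigr => i _; rewrite coord_formE.
Qed.

(** Here X_p is paired with Hom(X_((p^-1)^-1), k), whence the casts along
    (p^-1)^-1 = p. *)
Lemma pairing_gdual X : dual_pairing X (gdual X).
Proof.
exists (fun p m (f : 'Hom(X p^-1^-1%g, k^o)) => f (gcast X p p^-1^-1%g m))
  (fun p => \dim {:X p})
  (fun p i => (vbasis {:X p})`_i)
  (fun p i => (coord_form i \o gcast X p^-1^-1%g p)%VF : 'Hom(_, _)).
- by move=> p f c m n; rewrite !linearP.
- by move=> p m c f g; rewrite lfun_combE.
- by move=> p a m f; rewrite gdualE gcast_act -aut_actM mulVg aut_act1.
- move=> p m; rewrite [RHS](coord_vbasis (memvf m)).
  apply: eq_bigr => i _.
  by rewrite comp_lfunE coord_formE gcastK ?invgK.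
- move=> p f; apply/lfunP=> m.
  have -> : f m = (f \o gcast X p p^-1^-1%g)%VF (gcast X p^-1^-1%g p m).
    by rewrite comp_lfunE gcastK ?invgK.
  rewrite -[RHS]coord_form_sum sum_lfunE.
  apply: eq_bigr => i _; rewrite scale_lfunE !comp_lfunE coord_formE.
  exact: mulrC.
Qed.

(** * The rigidity criterion *)

Theorem graded_rep_rigid : rigid RepQ <-> (#|A|%:R : k) != 0.
Proof.
split=> [rig|A0 X].
  have [[Y dual] _] := rig (fun _ => rep_triv).
  exact: right_dual_triv dual.
split; exists (gdual X); first exact: pairing_right_dual (pairing_gdual X) A0.
exact/left_dual_of_right_dual/(pairing_right_dual (gdual_pairing X) A0).
Qed.

End GradedDuality.

Theorem proposition5p28 (k : fieldType) (gT hT : finGroupType)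
    (X : crossed_module gT hT) :
  rigid (RepG X k) <->
  (forall p : nat, p \in [pchar k] -> ~~ (p %| #|cm_L X|)%N).
Proof.
have card_Lt : #|cm_Lt X| = #|cm_L X|.
  by rewrite (card_isog (isog_subg (cm_L X))) cardsT.
apply: (iff_trans (graded_rep_rigid k (@cm_Lt_comm _ _ X) (cm_abar X))).
rewrite card_Lt natf_neq0_pchar.
split=> [/(pnatP _ (cardG_gt0 _)) pL p pk|pL].
  by apply/negP=> /(pL p (pcharf_prime pk)); rewrite inE /= pk.
apply/(pnatP _ (cardG_gt0 _)) => p _ pd.
by rewrite inE /=; apply: contraL pd => /pL.
Qed.
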